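(* Let $m$ be any positive integer (the epoch length). Put $\Delta_0:=\tilde\Delta_0=1-\tilde x_0^Tx^*$ and suppose the step size $\eta\in(0,1]$, the batch size $s$ and the initial iterate $\tilde x_0\in\partial\mathcal B_d$ satisfy $$\Delta_0\le\min\left\{1-\frac1{\sqrt2},\ \frac{(\lambda^*-\bar\lambda)^2}{4(M+2\sqrt{L_0})^2}\right\},\tag{A}$$ at least one of the two conditions $$L\le\frac{(\lambda^*-\bar\lambda-2M\sqrt{\Delta_0})^2}{32}\qquad\text{(B)}\qquad\qquad\text{or}\qquad\qquad \eta\le\frac1{\max(1,\nu_1,\nu_2,\nu_3)}\qquad\text{(C)},$$ and $$\eta\le\frac1{\max(1,\nu_4,\nu_5)},\tag{D}$$ where $$\nu_1=1-\lambda^*+2\theta_1m\sqrt{2\Delta_0},\qquad \nu_2=m\lambda^*+1-(m+1)(\bar\lambda+M\sqrt{\Delta_0}),$$ $$\nu_3=\frac{128L\theta_1\lambda^*m^2}{\theta_2^2\bar\lambda\Delta_0\sqrt{\Delta_0}}+1-(\bar\lambda+M\sqrt{\Delta_0}),$$ $$\nu_4=1-\lambda^*-M\sqrt{\Delta_0}+\max\left(\sqrt{Km},\ \frac{64K}{\lambda^*-\bar\lambda-2M\sqrt{\Delta_0}}\right),$$ $$\nu_5=1-\lambda^*+M\sqrt{\Delta_0}+\max\left(2m\bigl(\lambda^*-\bar\lambda-2M\sqrt{\Delta_0}\bigr),\ \frac{4mM\sqrt{\Delta_0}}{\log2}\right),$$ $$\theta_1=\lambda^*+\sigma+M\sqrt{\Delta_0/2}+2\sqrt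 L,\qquad \theta_2=\lambda^*-\bar\lambda-2\sqrt{\Delta_0}\,(M+2\sqrt L).$$ Let $$\rho=\frac{\eta m\bigl(\lambda^*-\bar\lambda-2M\sqrt{\Delta_0}\bigr)}{2\bigl(1-\eta+\eta(\lambda^*-M\sqrt{\Delta_0})\bigr)}.$$ Then for any $\epsilon>0$, after $\tau=\lceil(1/\rho)\log(\tilde\delta_0/\epsilon)\rceil$ epochs of S-SCI-PI (defined in the context), we have $\tilde\delta_\tau\le\epsilon$.
   Context: All norms are Euclidean norms (spectral norms for matrices). $\mathcal B_d=\{y\in\mathbb R^d:\|y\|\le1\}$, $\partial\mathcal B_d=\{y\in\mathbb R^d:\|y\|=1\}$, $[n]=\{1,\dots,n\}$, $d\ge 2$. Problem: maximize $f(x)=\frac1n\sum_{i=1}^nf_i(x)$ over $x\in\partial\mathcal B_d$. The functions $f_i$ are scale invariant of the same type: either all satisfy $f_i(cx)=|c|^pf_i(x)$ with a common $p$ (multiplicative case), or all satisfy $f_i(cx)=f_i(x)+\log_a|c|$ for $c\neq0$ with a common base $a$ (additive case), in which case one sets $p:=0$. The $f_i$ are differentiable enough for everything below to make sense: each $f_i$ has components of its gradient twice continuously differentiable on an open set containing $\partial\mathcal B_d$, the derivatives used below exist at the points of $\mathcal B_d$ where they are evaluated, and the maxima defining the constants below exist and are finite. Local solution: $x^*\in\partial\mathcal B_d$ is a local optimal solution with $\nabla f(x^* )=\lambda^*x^*$. $(\lambda_i,v_i)$, $1\le i\le d$, are eigenpairs of $\nabla^2f(x^* )$ with $v_1,\dots,v_d$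 an orthonormal basis and $v_1=x^*$ ($x^*$ is an eigenvector by scale invariance). $\sigma=\|\nabla^2f(x^* )\|$. It is assumed that $\lambda^*>\bar\lambda:=\max_{2\le i\le d}|\lambda_i|$. Notation: $\nabla_jf$ is the $j$-th coordinate of $\nabla f$; $H_j$ is the Hessian of $\nabla_jf$; $v_{ij}$ is the $j$-th coordinate of $v_i$; $F_i(y^1,\dots,y^d)=(\lambda^*-\lambda_1)\mathbf 1_{i=1}I+\sum_{j=1}^dv_{ij}H_j(y^j)$. For $S\subset[n]$, $f_S=\frac1{|S|}\sum_{l\in S}f_l$, $g_S=f_S-f$, and $G_S(y^1,\dots,y^d)$ is the $d\times d$ matrix whose $j$-th row is $(\nabla\nabla_jg_S(y^j))^T$. Constants: $M=\max(M_1,M_2)$ with $$M_1=\max_{x\in\partial\mathcal B_d,\,y^1,\dots,y^d\in\mathcal B_d}\sqrt{\textstyle\sum_{i=1}^d(x^TF_i(y^1,\dots,y^d)x)^2},\qquad M_2=\max_{x,z\in\partial\mathcal B_d,\,y^1,\dots,y^d\in\mathcal B_d}\Bigl|\textstyle\sum_{i=1}^dz_i\,x^TH_i(y^i)x\Bigr|.$$ $B_s$ is the set of all $S\subset[n]$ with $|S|=s$; $K=\max_{y^1,\dots,y^d\in\mathcal B_d}E_{S\sim B_s}[\|G_S(y^1,\dots,y^d)\|^2]$ ($S$ uniform on $B_s$); $L=\max_{S\in B_s,\,y^1,\dots,y^d\in\mathcal B_d}\|G_S(y^1,\dots,y^d)\|^2$, and $L_0$ is the value of $L$ for $s=1$ (an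 upper bound of $L$ for every $s$). Algorithm S-SCI-PI with step size $\eta\in(0,1]$, batch size $s\in[n]$, epoch length $m$, and initial outer iterate $\tilde x_0\in\partial\mathcal B_d$: for each epoch $T=0,1,2,\dots$, set $x_0=\tilde x_T$; for $t=0,1,\dots,m-1$ let $\alpha_t=|x_t^Tx_0|^{p-1}/\|x_0\|^{2(p-1)}$, sample $S_t\subset[n]$ of size $s$ uniformly at random (independently of everything before), and set $$g_t=\alpha_t\nabla f(x_0)+\frac1s\sum_{l\in S_t}\bigl[\nabla f_l(x_t)-\alpha_t\nabla f_l(x_0)\bigr],\qquad x_{t+1}=(1-\eta)x_t+\eta\,g_t/\|x_t\|^{p-2};$$ then set $\tilde x_{T+1}=x_m$. It is implicit that the iterates are well defined (in particular nonzero). The optimality gap after $T$ epochs is $$\tilde\delta_T=\frac{E\bigl[\sum_{k=2}^d(\tilde x_T^Tv_k)^2\bigr]}{E[(\tilde x_T^Tv_1)^2]},$$ $E$ being the total expectation over all the randomness of the algorithm; $\tilde\Delta_0$ is treated as a deterministic number. Conditions (C) and (D) presuppose that the denominators in $\nu_3$, respectively $\nu_4$, are nonzero. *)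

(* Defs.v *)
(* Vectors of R^d are columns 'cV[R]_d.+1, so that the dimension is d.+1 and
   ord0 is the index written 1 on paper. *)
From HB Require Import structures.
From mathcomp Require Import all_boot all_order all_algebra.
From mathcomp Require Import all_classical all_reals all_analysis.

Set Implicit Arguments.
Unset Strict Implicit.
Unset Printing Implicit Defensive.

Import Order.TTheory GRing.Theory Num.Theory.
Import numFieldNormedType.Exports.

Local Open Scope classical_set_scope.
Local Open Scope ring_scope.

Section Euclidean.
Context {R : realType} {d : nat}.

Definition dotv (u v : 'cV[R]_d.+1) : R := \sum_i u i 0 * v i 0.

(* The library norm `|x| on matrices is the sup norm; it only serves to define
   the (norm-independent) topology and derivatives. *)
Definition norm2 (u : 'cV[R]_d.+1) : R := Num.sqrt (\sum_i u i 0 ^+ 2).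

Definition unit_ball : set 'cV[R]_d.+1 := [set x | norm2 x <= 1].
Definition unit_sphere : set 'cV[R]_d.+1 := [set x | norm2 x = 1].

(* operator norm induced by the Euclidean norm *)
Definition spectral_norm (A : 'M[R]_d.+1) : R :=
  sup [set norm2 (A *m x) | x in unit_sphere].

End Euclidean.

Definition is_max {R : realType} (A : set R) (r : R) : Prop :=
  A r /\ ubound A r.

Section Calculus.
Context {R : realType} {d : nat}.
Implicit Types (h : 'cV[R]_d.+1 -> R) (U : set 'cV[R]_d.+1).

Definition partial (j : 'I_d.+1) h : 'cV[R]_d.+1 -> R :=
  fun x => 'D_(delta_mx j 0) h x.

Definition has_partial (j : 'I_d.+1) h (x : 'cV[R]_d.+1) : Prop :=
  derivable h x (delta_mx j 0).

Definition grad h (x : 'cV[R]_d.+1) : 'cV[R]_d.+1 :=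
  \col_j partial j h x.

(* row j is the transposed gradient of the j-th partial derivative *)
Definition hess h (x : 'cV[R]_d.+1) : 'M[R]_d.+1 :=
  \matrix_(j, k) partial k (partial j h) x.

Definition C1_on U h : Prop := forall x, U x ->
  differentiable h x /\ forall j, {for x, continuous (partial j h)}.

Definition C2_on U h : Prop :=
  C1_on U h /\ forall j, C1_on U (partial j h).

Definition grad_C2_near_sphere h : Prop :=
  exists U : set 'cV[R]_d.+1, [/\ open U, unit_sphere `<=` U,
    forall x, U x -> differentiable h x & forall j, C2_on U (partial j h)].

End Calculus.

Section FiniteSum.
Context {R : realType} {d n : nat}.
Implicit Type f : 'I_n -> 'cV[R]_d.+1 -> R.

Definition favg f : 'cV[R]_d.+1 -> R :=
  fun x => n%:R^-1 * \sum_l f l x.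

Definition fbatch f (S : {set 'I_n}) : 'cV[R]_d.+1 -> R :=
  fun x => #|S|%:R^-1 * \sum_(l in S) f l x.

(* All f_l are scale invariant of one type: homogeneous of degree p, or
   additively so with p = 0.  The identities are required away from the
   origin, where |c|^p and log_a |c| make sense for every p. *)
Definition scale_invariant f (p : R) : Prop :=
  (forall l (c : R) (x : 'cV[R]_d.+1), c != 0 -> x != 0 ->
     f l (c *: x) = `|c| `^ p * f l x) \/
  (p = 0 /\ exists a : R, [/\ 0 < a, a != 1 &
     forall l (c : R) (x : 'cV[R]_d.+1), c != 0 -> x != 0 ->
       f l (c *: x) = f l x + ln `|c| / ln a]).

(* The derivatives entering H_j and G_S exist on the closed unit ball. *)
Definition derivatives_on_ball f : Prop :=
  forall y, unit_ball y ->
    (forall l j, has_partial j (f l) y) /\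
    (forall l j k, has_partial k (partial j (f l)) y) /\
    (forall i j k, has_partial i (partial k (partial j (favg f))) y).

Definition Hmx f (j : 'I_d.+1) (y : 'cV[R]_d.+1) : 'M[R]_d.+1 :=
  hess (partial j (favg f)) y.

Definition Fmx f (lams : R) (lam : 'I_d.+1 -> R)
    (v : 'I_d.+1 -> 'cV[R]_d.+1) (i : 'I_d.+1)
    (y : 'I_d.+1 -> 'cV[R]_d.+1) : 'M[R]_d.+1 :=
  (if i == ord0 then (lams - lam ord0)%:M else 0)
  + \sum_j v i j 0 *: Hmx f j (y j).

Definition Gmx f (S : {set 'I_n}) (y : 'I_d.+1 -> 'cV[R]_d.+1) : 'M[R]_d.+1 :=
  \matrix_(j, k)
    (grad (partial j (fun x => fbatch f S x - favg f x)) (y j)) k 0.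

Definition batches (s : nat) : {set {set 'I_n}} :=
  [set S : {set 'I_n} | #|S| == s].

Definition Ebatch (s : nat) (X : {set 'I_n} -> R) : R :=
  #|batches s|%:R^-1 * \sum_(S in batches s) X S.

Definition M1_values f lams lam v : set R :=
  [set r | exists x y, [/\ unit_sphere x, forall i, unit_ball (y i) &
    r = Num.sqrt (\sum_i dotv x (Fmx f lams lam v i y *m x) ^+ 2)]].

Definition M2_values f : set R :=
  [set r | exists x z y,
    [/\ unit_sphere x, unit_sphere z, forall i, unit_ball (y i) &
      r = `|\sum_i z i 0 * dotv x (Hmx f i (y i) *m x)|]].

Definition K_values f s : set R :=
  [set r | exists y, (forall i, unit_ball (y i)) /\
    r = Ebatch s (fun S => spectral_norm (Gmx f S y) ^+ 2)].

Definition L_values f s : set R :=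
  [set r | exists S y, [/\ S \in batches s, forall i, unit_ball (y i) &
    r = spectral_norm (Gmx f S y) ^+ 2]].

End FiniteSum.

Section Algorithm.
Context {R : realType} {d n : nat}.
Variables (f : 'I_n -> 'cV[R]_d.+1 -> R) (p eta : R) (s m : nat).
Implicit Types (x y : 'cV[R]_d.+1) (S : {set 'I_n}).

(* y is the reference point x_0 of the epoch, x the current iterate x_t *)
Definition vr_alpha y x : R :=
  `|dotv x y| `^ (p - 1) / norm2 y `^ (2 * (p - 1)).

Definition vr_grad y x S : 'cV[R]_d.+1 :=
  vr_alpha y x *: grad (favg f) y
  + s%:R^-1 *: \sum_(l in S) (grad (f l) x - vr_alpha y x *: grad (f l) y).

Definition vr_step y x S : 'cV[R]_d.+1 :=
  (1 - eta) *: x + eta *: ((norm2 x `^ (p - 2))^-1 *: vr_grad y x S).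

(* x_t, for the batches u = [:: S_0; ...; S_(t-1)] drawn so far in an epoch
   that starts at y *)
Definition inner_iter y (u : seq {set 'I_n}) : 'cV[R]_d.+1 :=
  foldl (vr_step y) y u.

(* \tilde x_T, for the batches of the first T epochs *)
Definition outer_iter T (w : T.-tuple (m.-tuple {set 'I_n})) x :
    'cV[R]_d.+1 :=
  foldl (fun y (u : m.-tuple {set 'I_n}) => inner_iter y u) x w.

(* The outcomes of the first T epochs.  Independent uniform draws from the
   batches of size s are exactly the uniform law on this finite set, so the
   total expectation is the average over it. *)
Definition outcomes T : {set T.-tuple (m.-tuple {set 'I_n})} :=
  [set w : T.-tuple (m.-tuple {set 'I_n}) |
    all (fun u : m.-tuple {set 'I_n} => all (mem (batches s)) u) w].

Definition Etotal T (X : T.-tuple (m.-tuple {set 'I_n}) -> R) : R :=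
  #|outcomes T|%:R^-1 * \sum_(w in outcomes T) X w.

(* Every x_t that can be reached is nonzero, and no negative power of
   |x_t^T x_0| = 0 occurs in alpha_t. *)
Definition iterates_well_defined x : Prop :=
  forall T (w : T.-tuple (m.-tuple {set 'I_n})) (u : seq {set 'I_n}),
    w \in outcomes T -> all (mem (batches s)) u -> (size u < m)%N ->
    let x0 := outer_iter w x in let xt := inner_iter x0 u in
    xt != 0 /\ (p < 1 -> dotv xt x0 != 0).

Variable v : 'I_d.+1 -> 'cV[R]_d.+1.

Definition gap_num x T : R :=
  Etotal (fun w : T.-tuple _ =>
    \sum_(k | k != ord0) dotv (outer_iter w x) (v k) ^+ 2).

Definition gap_den x T : R :=
  Etotal (fun w : T.-tuple _ => dotv (outer_iter w x) (v ord0) ^+ 2).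

Definition gap x T : R := gap_num x T / gap_den x T.

End Algorithm.

(* ceiling of a real as a number of epochs: 0 when the ceiling is negative *)
Definition nat_ceil {R : realType} (r : R) : nat :=
  absz (Num.max (0 : int) (Num.ceil r)).

(* Main.v *)
Require Import Defs.
From HB Require Import structures.
From mathcomp Require Import all_boot all_order all_algebra.
From mathcomp Require Import all_classical all_reals all_analysis.
From mathcomp Require Import perm ring lra.

Set Implicit Arguments.
Unset Strict Implicit.
Unset Printing Implicit Defensive.

Import Order.TTheory GRing.Theory Num.Theory.
Import numFieldNormedType.Exports.

Local Open Scope classical_set_scope.
Local Open Scope ring_scope.

(** Write P x for the component of x along the optimum xs = v_1, and tang x for
    the component orthogonal to it.  The gap is E |tang x|^2 / E (P x)^2, and the
    claim is that each epoch multiplies it by at most 1 - rho.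

    Homogeneity lets one step be read off at the normalised iterate.  There the
    gradient is its linearisation at xs, diagonal in the basis v with entry lams
    along xs and entries of modulus at most lamb elsewhere, plus a Taylor remainder
    that M and the angle to xs control ([grad_remainder], [drift_rem_le]); the constant
    lams - lam_1 that occurs in F_1 is what turns the eigenvalue lam_1 into lams.
    So one noiseless step multiplies P by at least bm = 1 - eta + eta (lams - mu)
    and |tang| by at most al = 1 - eta + eta (lamb + mu), with
    mu = M sqrt D0, and al = bm - eta G with G = lams - lamb - 2 mu > 0.

    The sampled gradients add a centred noise.  By homogeneity it is a difference
    of grad (f_S - f) between the normalised iterate and a multiple of the
    reference point, so that the mean value theorem bounds it by sqrt L, and its
    mean square by K, times the distance of the iterate from the line through the
    reference point ([noise_energy]).  K is a maximum over points common to
    all batches; a mean value theorem applied to a single scalar function, the sum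
    over all batches, provides such a common point.

    Two consequences follow.  Almost surely the angle to xs never exceeds the angle
    at the start of the epoch ([inner_invariant]): the noise is at most
    sqrt L times the displacement of the slope tang x / P x since the start, which
    is at most twice the initial slope, and also at most proportional to eta times
    the number of steps.  The first bound suffices when L is small against G^2,
    the second when eta is small.  This keeps all iterates in the region where the
    bounds above hold.  In mean square, |tang|^2 obeys a linear recursion with factor al^2
    and a source proportional to eta^2 K ([Ebatch_tang]), while P^2 grows by bm^2
    to bp^2, bp = 1 - eta + eta (lams + mu), up to the same kind of error
    ([Ebatch_P_ge], [Ebatch_P_le]).  The bounds on eta make the source
    small against the contraction eta G, and the m-step recursion closes
    with the factor (1 - rho) bm^(2m) for |tang|^2, against at least bm^(2m) for
    P^2 ([epoch_recursion], [epoch_tang], [epoch_P]).  Numerator and denominator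
    obey linear bounds that hold from every point of a cone, hence they can
    be iterated over the epochs without conditioning ([gap_contraction]). *)

(** * Euclidean geometry *)

Section Euclid.
Context {R : realType} {d : nat}.
Implicit Types (x y z : 'cV[R]_d.+1) (c : R).

Lemma dotvC x y : dotv x y = dotv y x.
Proof. by apply: eq_bigr => i _; rewrite mulrC. Qed.

Lemma dotvDl x y z : dotv (x + y) z = dotv x z + dotv y z.
Proof. by rewrite -big_split; apply: eq_bigr => i _; rewrite mxE mulrDl. Qed.

Lemma dotvZl c x y : dotv (c *: x) y = c * dotv x y.
Proof. by rewrite big_distrr; apply: eq_bigr => i _; rewrite mxE /= mulrA. Qed.

Lemma dotvDr x y z : dotv x (y + z) = dotv x y + dotv x z.
Proof. by rewrite dotvC dotvDl !(dotvC x). Qed.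

Lemma dotvZr c x y : dotv x (c *: y) = c * dotv x y.
Proof. by rewrite dotvC dotvZl dotvC. Qed.

Lemma dotvNl x y : dotv (- x) y = - dotv x y.
Proof. by rewrite -scaleN1r dotvZl mulN1r. Qed.

Lemma dotvNr x y : dotv x (- y) = - dotv x y.
Proof. by rewrite dotvC dotvNl dotvC. Qed.

Lemma dotv0l y : dotv 0 y = 0.
Proof. by rewrite -(scale0r 0) dotvZl mul0r. Qed.

Lemma dotv0r y : dotv y 0 = 0.
Proof. by rewrite dotvC dotv0l. Qed.

Lemma dotv_suml I (r : seq I) (P : pred I) (F : I -> 'cV[R]_d.+1) y :
  dotv (\sum_(i <- r | P i) F i) y = \sum_(i <- r | P i) dotv (F i) y.
Proof.
by apply: (big_ind2 (fun x c => dotv x y = c)) => [|x1 c1 x2 c2 <- <-|//];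
  rewrite ?dotv0l ?dotvDl.
Qed.

Lemma dotv_sumr I (r : seq I) (P : pred I) (F : I -> 'cV[R]_d.+1) y :
  dotv y (\sum_(i <- r | P i) F i) = \sum_(i <- r | P i) dotv y (F i).
Proof. by rewrite dotvC dotv_suml; apply: eq_bigr => i _; rewrite dotvC. Qed.

Lemma dotv_ge0 x : 0 <= dotv x x.
Proof. by apply: sumr_ge0 => i _; rewrite -expr2 sqr_ge0. Qed.

Lemma norm2E x : norm2 x = Num.sqrt (dotv x x).
Proof. by congr Num.sqrt; apply: eq_bigr => i _; rewrite expr2. Qed.

Lemma norm2_ge0 x : 0 <= norm2 x.
Proof. exact: sqrtr_ge0. Qed.

Lemma norm2_sqr x : norm2 x ^+ 2 = dotv x x.
Proof. by rewrite norm2E sqr_sqrtr ?dotv_ge0. Qed.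

Lemma dotv_eq0 x : (dotv x x == 0) = (x == 0).
Proof.
apply/idP/eqP => [|->]; last by rewrite dotv0l.
rewrite psumr_eq0 => [/allP h|i _]; last by rewrite -expr2 sqr_ge0.
apply/matrixP => i j; rewrite ord1 mxE.
by have := h i (mem_index_enum i); rewrite -expr2 sqrf_eq0 => /eqP.
Qed.

Lemma norm2_eq0 x : (norm2 x == 0) = (x == 0).
Proof. by rewrite -(sqrf_eq0 (norm2 x)) norm2_sqr dotv_eq0. Qed.

Lemma norm2_gt0 x : (0 < norm2 x) = (x != 0).
Proof. by rewrite lt_def norm2_ge0 norm2_eq0 andbT. Qed.

Lemma norm2Z c x : norm2 (c *: x) = `|c| * norm2 x.
Proof.
by rewrite !norm2E dotvZl dotvZr mulrA -expr2 sqrtrM ?sqr_ge0 // sqrtr_sqr.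
Qed.

Lemma norm2N x : norm2 (- x) = norm2 x.
Proof. by rewrite -scaleN1r norm2Z normrN1 mul1r. Qed.

(** The vector |y|^2 x - (x.y) y has a nonnegative square. *)
Lemma cauchy_schwarz x y : `|dotv x y| <= norm2 x * norm2 y.
Proof.
rewrite -(@ler_pXn2r _ 2) // ?nnegrE ?mulr_ge0 ?norm2_ge0 //.
rewrite exprMn !norm2_sqr real_normK ?num_real //.
have [->|y0] := eqVneq y 0; first by rewrite !dotv0r expr0n mulr0.
have yp : 0 < dotv y y by rewrite lt_def dotv_eq0 y0 dotv_ge0.
have := dotv_ge0 (dotv y y *: x - dotv x y *: y).
rewrite !(dotvDl, dotvDr, dotvNl, dotvNr, dotvZl, dotvZr) (dotvC y x) => h.
rewrite -(ler_pM2l yp) -subr_ge0; apply: le_trans h _.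
by rewrite le_eqVlt; apply/orP; left; apply/eqP; ring.
Qed.

Lemma dotv_le x y : dotv x y <= norm2 x * norm2 y.
Proof. exact: le_trans (ler_norm _) (cauchy_schwarz x y). Qed.

Lemma norm2D x y : norm2 (x + y) <= norm2 x + norm2 y.
Proof.
rewrite -(@ler_pXn2r _ 2) // ?nnegrE ?addr_ge0 ?norm2_ge0 //.
rewrite sqrrD !norm2_sqr !(dotvDl, dotvDr) (dotvC y x).
by have := dotv_le x y; lra.
Qed.

Lemma norm2_sum I (r : seq I) (P : pred I) (F : I -> 'cV[R]_d.+1) :
  norm2 (\sum_(i <- r | P i) F i) <= \sum_(i <- r | P i) norm2 (F i).
Proof.
apply: (big_ind2 (fun x c => norm2 x <= c)) => [|x1 c1 x2 c2 h1 h2|//].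
  by rewrite norm2E dotv0l sqrtr0.
by apply: le_trans (norm2D _ _) _; exact: lerD.
Qed.

Lemma sphere_dotv x : unit_sphere x -> dotv x x = 1.
Proof. by rewrite /unit_sphere /= -norm2_sqr => ->; rewrite expr1n. Qed.

Lemma sphere_normalize x : x != 0 -> unit_sphere ((norm2 x)^-1 *: x).
Proof.
move=> x0; rewrite /unit_sphere /= norm2Z ger0_norm ?invr_ge0 ?norm2_ge0 //.
by rewrite mulVf // norm2_eq0.
Qed.

Lemma ball_segment x y (t : R) : unit_ball x -> unit_ball y -> 0 <= t <= 1 ->
  unit_ball (x + t *: (y - x)).
Proof.
rewrite /unit_ball /= => hx hy /andP[t0 t1].
have -> : x + t *: (y - x) = (1 - t) *: x + t *: y.
  by rewrite scalerBr scalerBl scale1r addrCA addrC -addrA.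
apply: le_trans (norm2D _ _) _; rewrite !norm2Z !ger0_norm ?subr_ge0 //.
have := ler_wpM2l t0 hy; have : 0 <= 1 - t by lra.
by move=> h; have := ler_wpM2l h hx; lra.
Qed.

Lemma mulmx_dotv (A : 'M[R]_d.+1) x i : (A *m x) i 0 = dotv (row i A)^T x.
Proof. by rewrite mxE; apply: eq_bigr => j _; rewrite !mxE. Qed.

Lemma spectral_has_ub (A : 'M[R]_d.+1) :
  has_ubound [set norm2 (A *m x) | x in unit_sphere].
Proof.
exists (Num.sqrt (\sum_i norm2 (row i A)^T ^+ 2)) => _ [x hx <-].
rewrite {1}/norm2 ler_sqrt; last by apply: sumr_ge0 => i _; exact: sqr_ge0.
apply: ler_sum => i _; rewrite mulmx_dotv.
rewrite -(real_normK (num_real _)) ler_pXn2r ?nnegrE ?norm2_ge0 //.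
by have := cauchy_schwarz (row i A)^T x; rewrite (hx : norm2 x = 1) mulr1.
Qed.

Lemma norm2_delta (i : 'I_d.+1) : norm2 (delta_mx i 0 : 'cV[R]_d.+1) = 1.
Proof.
rewrite /norm2 (bigD1 i) //= big1 => [|j ji]; rewrite !mxE.
  by rewrite !eqxx expr1n addr0 sqrtr1.
by rewrite (negPf ji) expr0n.
Qed.

Lemma spectral_norm_ge (A : 'M[R]_d.+1) x :
  norm2 (A *m x) <= spectral_norm A * norm2 x.
Proof.
have [->|x0] := eqVneq x 0.
  by rewrite mulmx0 !norm2E dotv0l sqrtr0 mulr0.
have /(ub_le_sup (spectral_has_ub A)) : [set norm2 (A *m x) | x in unit_sphere]
    (norm2 (A *m ((norm2 x)^-1 *: x))).
  by exists ((norm2 x)^-1 *: x) => //; exact: sphere_normalize.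
rewrite -scalemxAr norm2Z ger0_norm ?invr_ge0 ?norm2_ge0 // mulrC.
by rewrite ler_pdivrMr ?norm2_gt0.
Qed.

Lemma spectral_norm_le (A : 'M[R]_d.+1) c :
  (forall x, unit_sphere x -> norm2 (A *m x) <= c) -> spectral_norm A <= c.
Proof.
move=> h; apply: ge_sup => [|_ [x hx <-]]; last exact: h.
by exists (norm2 (A *m delta_mx 0 0)), (delta_mx 0 0) => //; exact: norm2_delta.
Qed.

Lemma spectral_norm_ge0 (A : 'M[R]_d.+1) : 0 <= spectral_norm A.
Proof.
have := spectral_norm_ge A (delta_mx 0 0).
by rewrite norm2_delta mulr1; apply: le_trans; exact: norm2_ge0.
Qed.

End Euclid.

Section OrthonormalBasis.
Context {R : realType} {d : nat} (v : 'I_d.+1 -> 'cV[R]_d.+1).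
Hypothesis v_orthonormal : forall i j, dotv (v i) (v j) = (i == j)%:R.
Implicit Types x y : 'cV[R]_d.+1.

(** The matrix with columns v k has a left inverse, its transpose, which is then
    also a right inverse. *)
Lemma orthonormal_expand x : x = \sum_k dotv x (v k) *: v k.
Proof.
pose V : 'M[R]_d.+1 := \matrix_(i, j) v j i 0.
have VV : V^T *m V = 1%:M.
  apply/matrixP => i j; rewrite !mxE -v_orthonormal.
  by apply: eq_bigr => k _; rewrite !mxE.
have {}VV := mulmx1C VV; rewrite -[LHS]mul1mx -VV -mulmxA.
apply/matrixP => i j; rewrite ord1 mxE summxE; apply: eq_bigr => k _.
rewrite !mxE mulrC; congr (_ * _).
by apply: eq_bigr => l _; rewrite !mxE mulrC.
Qed.

Lemma parseval x y : dotv x y = \sum_k dotv x (v k) * dotv y (v k).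
Proof.
rewrite {1}(orthonormal_expand y) dotv_sumr.
by apply: eq_bigr => k _; rewrite dotvZr mulrC.
Qed.

Lemma dotv_basis (c : 'I_d.+1 -> R) k : dotv (\sum_i c i *: v i) (v k) = c k.
Proof.
rewrite dotv_suml (bigD1 k) //= big1 => [|i ik].
  by rewrite dotvZl v_orthonormal eqxx mulr1 addr0.
by rewrite dotvZl v_orthonormal (negPf ik) mulr0.
Qed.

End OrthonormalBasis.

(** * Averages over finite sequences of independent draws *)

Section SequenceAverage.
Context {R : realType} {A : finType} (B : {set A}).
Implicit Types (X Y : seq A -> R).

Definition mean (h : A -> R) : R := #|B|%:R^-1 * \sum_(a in B) h a.

(** Iterated averages.  Peeling off the first or the last draw
    ([seqmean_rcons]) plays the part of conditioning on it. *)
Fixpoint seqmean k X : R :=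
  if k is k'.+1 then mean (fun a => seqmean k' (fun u => X (a :: u))) else X [::].

Lemma eq_mean h h' : h =1 h' -> mean h = mean h'.
Proof. by move=> e; rewrite /mean; congr (_ * _); apply: eq_bigr. Qed.

Lemma eq_seqmean k X Y : X =1 Y -> seqmean k X = seqmean k Y.
Proof.
elim: k X Y => [|k IH] X Y e /=; first exact: e.
by apply: eq_mean => a; apply: IH => u; exact: e.
Qed.

Lemma sum_tuple_cons k (X : k.+1.-tuple A -> R) :
  \sum_(w : k.+1.-tuple A | all (mem B) w) X w =
  \sum_(a in B) \sum_(w : k.-tuple A | all (mem B) w) X [tuple of a :: w].
Proof.
rewrite pair_big_dep /=.
pose g (z : A * k.-tuple A) : k.+1.-tuple A := [tuple of z.1 :: z.2].
pose g' (w : k.+1.-tuple A) : A * k.-tuple A := (thead w, [tuple of behead w]).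
rewrite (reindex g) /=; first by apply: eq_bigl => -[a w].
exists g' => [[a w] _|w _]; last by rewrite /g /g' /= -tuple_eta.
by rewrite /g /g' /=; congr (_, _); apply/val_inj.
Qed.

Lemma seqmean_sum k X : seqmean k X =
  #|B|%:R^-1 ^+ k * \sum_(w : k.-tuple A | all (mem B) w) X w.
Proof.
elim: k X => [|k IH] X.
  rewrite expr0 mul1r (big_pred1 [tuple]) // => w.
  by rewrite tuple0 /= eqxx.
rewrite sum_tuple_cons exprS -mulrA mulr_sumr /= /mean; congr (_ * _).
by apply: eq_bigr => a _; rewrite IH.
Qed.

Lemma card_tuples k : #|[set w : k.-tuple A | all (mem B) w]%SET| = (#|B| ^ k)%N.
Proof.
elim: k => [|k IH].
  rewrite expn0 (_ : [set w : 0.-tuple A | all (mem B) w]%SET = [set [tuple]]%SET) ?cards1 //.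
  by apply/setP => w; rewrite !inE tuple0 /= eqxx.
apply/eqP; rewrite -(eqr_nat R) -sum1_card natr_sum big_set /=.
rewrite (sum_tuple_cons (fun=> 1)) /=.
have -> : \sum_(w : k.-tuple A | all (mem B) w) (1 : R) = (#|B| ^ k)%:R.
  by rewrite -IH -sum1_card natr_sum big_set.
by rewrite sumr_const expnS natrM mulr_natl.
Qed.

Lemma seqmeanE k X : seqmean k X =
  #|[set w : k.-tuple A | all (mem B) w]%SET|%:R^-1 *
  \sum_(w in [set w : k.-tuple A | all (mem B) w]%SET) X w.
Proof.
rewrite card_tuples natrX -exprVn seqmean_sum; congr (_ * _).
by rewrite big_set.
Qed.

Lemma seqmean_rcons k X :
  seqmean k.+1 X = seqmean k (fun u => mean (fun a => X (rcons u a))).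
Proof.
elim: k X => [|k IH] X //.
rewrite -[LHS]/(mean (fun a => seqmean k.+1 (fun u => X (a :: u)))).
by apply: eq_mean => a; rewrite IH.
Qed.

Lemma mean_le h h' : (forall a, a \in B -> h a <= h' a) -> mean h <= mean h'.
Proof. by move=> e; rewrite ler_wpM2l ?invr_ge0 ?ler0n //; exact: ler_sum. Qed.

Lemma seqmean_le k X Y :
  (forall u, size u = k -> all (mem B) u -> X u <= Y u) ->
  seqmean k X <= seqmean k Y.
Proof.
elim: k X Y => [|k IH] X Y e /=; first exact: e.
apply: mean_le => a aB; apply: IH => u uk uB; apply: e; first by rewrite /= uk.
by rewrite /= aB.
Qed.

Lemma meanZD c c' h h' :
  mean (fun a => c * h a + c' * h' a) = c * mean h + c' * mean h'.
Proof. by rewrite /mean big_split /= -!mulr_sumr mulrDr !(mulrCA _^-1). Qed.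

Lemma seqmeanZD k c c' X Y :
  seqmean k (fun u => c * X u + c' * Y u) = c * seqmean k X + c' * seqmean k Y.
Proof.
elim: k X Y => [|k IH] X Y //=.
by rewrite -meanZD; apply: eq_mean => a; rewrite IH.
Qed.

Lemma seqmeanZ k c X : seqmean k (fun u => c * X u) = c * seqmean k X.
Proof.
have := seqmeanZD k c 0 X X; rewrite mul0r addr0 => <-.
by apply: eq_seqmean => u; rewrite mul0r addr0.
Qed.

End SequenceAverage.

(** * Calculus along a segment *)

(** The differential of f also approximates g, and such an approximation determines
    the differential by [diff_unique]. *)
Lemma near_eq_differentiable (R : numFieldType) (V W : normedModType R)
    (f g : V -> W) (x : V) :
  (\near x, f x = g x) -> differentiable f x -> differentiable g x.
Proof.
move=> fg df; have fgx : f x = g x by exact: nbhs_singleton fg.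
have dg : g \o shift x = cst (g x) + 'd f x +o_ 0 id.
  apply/eqaddoP => e e0.
  have [_ /eqaddoP /(_ e e0) fe] := (diff_locallyP _ _).1 df.
  have fg0 : \forall h \near (0 : V), f (h + x) = g (h + x).
    by have := fg; rewrite (near_shift 0) /=; apply: filterS => h; rewrite subr0.
  apply: filterS2 fe fg0 => h /=.
  rewrite -[(f \o shift x - _) h]/(f (h + x) - (f x + 'd f x h)).
  by rewrite -[(g \o shift x - _) h]/(g (h + x) - (g x + 'd f x h)) fgx => + <-.
have dE : 'd g x = 'd f x :> (V -> W).
  by apply: diff_unique => //; exact: diff_continuous.
by apply/diff_locallyP; rewrite dE; split => //; exact: diff_continuous.
Qed.

Section Line.
Context {R : realType} {d : nat}.
Implicit Types (h : 'cV[R]_d.+1 -> R) (x w : 'cV[R]_d.+1).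

Lemma delta_expand w : w = \sum_k w k 0 *: delta_mx k 0.
Proof.
rewrite {1}[w]matrix_sum_delta; apply: eq_bigr => i _.
by rewrite big_ord_recl big_ord0 addr0; congr (w _ _ *: delta_mx _ _).
Qed.

Lemma derive_partial h x w : differentiable h x ->
  'D_w h x = \sum_k w k 0 * partial k h x.
Proof.
move=> dh; rewrite deriveE // {1}[w]delta_expand linear_sum.
by apply: eq_bigr => k _; rewrite linearZ /= /partial deriveE.
Qed.

(** The growth rate of the restriction to a line is literally that of h in the
    direction w. *)
Lemma is_derive_line h x w (t : R) : differentiable h (x + t *: w) ->
  is_derive t 1 (fun s => h (x + s *: w))
    (\sum_k w k 0 * partial k h (x + t *: w)).
Proof.
move=> dh; rewrite -derive_partial //.
pose D (s : R) := s^-1 *: (h (s *: w + (x + t *: w)) - h (x + t *: w)).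
have DE : (fun s : R => s^-1 *: (((fun s => h (x + s *: w)) \o shift t)
    (s *: (1 : R)) - h (x + t *: w))) = D.
  apply/funext => s; rewrite /D /= -[s *: 1]/(s * 1) mulr1 scalerDl.
  by rewrite addrCA.
apply: DeriveDef; rewrite /derivable /derive DE //.
exact: diff_derivable dh.
Qed.

End Line.

(** Rolle's theorem for phi t + dphi t (1 - t) + C (1 - t)^2, with C such that the
    values at 0 and 1 agree. *)
Lemma taylor2 {R : realType} (phi dphi ddphi : R -> R) :
  (forall t : R, t \in `[0, 1] -> is_derive t 1 phi (dphi t)) ->
  (forall t : R, t \in `[0, 1] -> is_derive t 1 dphi (ddphi t)) ->
  exists2 c, c \in `]0, 1[ & phi 1 = phi 0 + dphi 0 + ddphi c / 2.
Proof.
move=> d1 d2; pose C := phi 1 - phi 0 - dphi 0.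
pose g t := phi t + dphi t * (1 - t) + C * (1 - t) ^+ 2.
have dg (t : R) : t \in `[0, 1] ->
    is_derive t (1 : R) g (ddphi t * (1 - t) - C * (2 * (1 - t))).
  move=> t01; have p1 := d1 t t01; have p2 := d2 t t01.
  have q : is_derive t (1 : R) (cst 1 - id : R -> R) (- 1).
    by apply: is_derive_eq; rewrite sub0r.
  have -> : g = (phi + dphi * (cst 1 - id)) +
                C \*: ((cst 1 - id) * (cst 1 - id)).
    by apply/funext => u; rewrite /g !fctE.
  have e := is_deriveD (is_deriveD p1 (is_deriveM p2 q))
                       (is_deriveZ C (is_deriveM q q)).
  apply: (is_derive_eq e).
  by rewrite !fctE /GRing.scale /=; ring.
have g01 : g 0 = g 1 by rewrite /g /C; ring.
have [||c c01 gc] := @Rolle _ g 0 1 ltr01 _ _ g01.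
- by move=> t t01; have [] := dg t (subset_itv_oo_cc t01).
- by apply: derivable_within_continuous => t t01; have [] := dg t t01.
exists c => //; have [_ e1] := dg c (subset_itv_oo_cc c01).
move: gc => [_]; rewrite e1 => e2; have c1 : 1 - c != 0.
  by rewrite gt_eqF // subr_gt0; move: c01; rewrite in_itv => /andP[].
have : ddphi c * (1 - c) = 2 * C * (1 - c) by lra.
by move/(mulIf c1) => ->; rewrite /C; field.
Qed.

Lemma mvt_unit {R : realType} (phi dphi : R -> R) :
  (forall t : R, t \in `[0, 1] -> is_derive t 1 phi (dphi t)) ->
  exists2 c, c \in `[0, 1] & phi 1 - phi 0 = dphi c.
Proof.
move=> dp; have cont : {within `[0, 1], continuous phi}.
  by apply: derivable_within_continuous => t t01; have [] := dp t t01.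
have dp' (t : R) : t \in `]0, 1[ -> is_derive t 1 phi (dphi t).
  by move=> t01; exact: dp t (subset_itv_oo_cc t01).
have [c c01 e] := @MVT_segment R phi dphi 0 1 ler01 dp' cont.
by exists c; rewrite // e subr0 mulr1.
Qed.

(** * Scale-invariant functions *)

Section Homogeneous.
Context {R : realType} {d : nat}.
Implicit Types (h : 'cV[R]_d.+1 -> R) (x w : 'cV[R]_d.+1).

Lemma near_neq0 x : x != 0 -> \forall y \near x, y != 0.
Proof.
move=> x0; have : open [set y : 'cV[R]_d.+1 | y != 0].
  have -> : [set y : 'cV[R]_d.+1 | y != 0] = ~` [set 0].
    by apply/seteqP; split => y /= /eqP.
  rewrite openC; apply: accessible_closed_set1.
  by apply: hausdorff_accessible; exact: norm_hausdorff.
by move=> o; apply: open_nbhs_nbhs.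
Qed.

(** In the additive case q = 0 and e c is log_a c; one differentiation
    makes e vanish, so both cases merge from the gradient on. *)
Definition homogeneous q (e : R -> R) h := forall c x, 0 < c -> x != 0 ->
  h (c *: x) = c `^ q * h x + e c.

(** Near x, the function h is a rescaling of its restriction to a neighbourhood of
    the sphere. *)
Lemma homogeneous_differentiable q e h : homogeneous q e h ->
  (forall u, unit_sphere u -> differentiable h u) ->
  forall x, x != 0 -> differentiable h x.
Proof.
move=> hom dh x x0; have n0 : 0 < norm2 x by rewrite norm2_gt0.
pose c := (norm2 x)^-1; have c0 : 0 < c by rewrite invr_gt0.
have hE : \forall y \near x,
    (norm2 x `^ q *: (h \o ( *:%R c)) + cst (e (norm2 x))) y = h y.
  have := near_neq0 x0; apply: filterS => y y0.
  rewrite !fctE /= /cst -[in RHS](scale1r y) -(mulfV (lt0r_neq0 n0)) -scalerA.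
  by rewrite [RHS]hom // scaler_eq0 negb_or y0 andbT lt0r_neq0.
apply: near_eq_differentiable hE _.
apply: differentiableD; last exact: differentiable_cst.
apply: differentiableZ; apply: differentiable_comp.
  by have [] := is_diff_scaler c x.
exact: dh (sphere_normalize x0).
Qed.

(** Two expressions of the partial derivative of y |-> h (c y), by the chain rule and
    by homogeneity. *)
Lemma partial_homogeneous q e h j : homogeneous q e h ->
  (forall x, x != 0 -> differentiable h x) ->
  homogeneous (q - 1) (fun=> 0) (partial j h).
Proof.
move=> hom dh c x c0 x0; rewrite addr0.
have cx0 : c *: x != 0 by rewrite scaler_eq0 negb_or x0 andbT lt0r_neq0.
have e1 : partial j (h \o ( *:%R c)) x = c * partial j h (c *: x).
  have dhc : differentiable h (c *: x) by exact: dh.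
  have -> : partial j (h \o ( *:%R c)) x = 'D_(c *: delta_mx j 0) h (c *: x).
    rewrite /partial /derive.
    set A := (X in lim (X @ _) = _); set B := (X in _ = lim (X @ _)).
    suff -> : A = B by [].
    apply/funext => s; rewrite /A /B /= [c *: (_ + _)]scalerDr.
    by rewrite [c *: (s *: _)]scalerA [s *: (c *: _)]scalerA (mulrC c s).
  by rewrite /partial !deriveE // linearZ.
have e2 : partial j (h \o ( *:%R c)) x = c `^ q * partial j h x.
  rewrite /partial.
  rewrite (@near_eq_derive _ _ _ _ (c `^ q *: h + cst (e c)) x); last first.
    by have := near_neq0 x0; apply: filterS => y y0; rewrite !fctE /= hom.
  have dhx : derivable h x (delta_mx j 0) by exact: diff_derivable (dh _ x0).
  have dqh := @derivableZ _ _ _ _ (c `^ q) _ _ dhx.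
  by rewrite (deriveD dqh (derivable_cst _ _ _)) (deriveZ _ dhx) derive_cst addr0.
apply: (mulfI (lt0r_neq0 c0)); rewrite -e1 e2 mulrA; congr (_ * _).
rewrite powRB ?lt0r_neq0 ?implybT // powRr1 ?ltW //; field.
exact: lt0r_neq0.
Qed.

End Homogeneous.

Section ScaleInvariant.
Context {R : realType} {d n : nat} (f : 'I_n -> 'cV[R]_d.+1 -> R) (p : R).
Hypothesis f_scale : scale_invariant f p.
Hypothesis f_smooth : forall l, grad_C2_near_sphere (f l).
Hypothesis f_ball : derivatives_on_ball f.

Lemma scale_invariant_homogeneous l : exists e, homogeneous p e (f l).
Proof.
case: f_scale => [h|[p0 [a [_ _ h]]]].
  exists (fun=> 0) => c x c0 x0; rewrite h ?gtr0_norm ?addr0 //.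
  exact: lt0r_neq0.
exists (fun c => ln c / ln a) => c x c0 x0.
by rewrite h ?gtr0_norm ?p0 ?powRr0 ?mul1r //; exact: lt0r_neq0.
Qed.

Lemma differentiable_off0 l x : x != 0 -> differentiable (f l) x.
Proof.
have [e he] := scale_invariant_homogeneous l.
apply: homogeneous_differentiable he _ _ => u hu.
by have [U [_ SU dU _]] := f_smooth l; exact/dU/SU.
Qed.

Lemma grad_homogeneous l j : homogeneous (p - 1) (fun=> 0) (partial j (f l)).
Proof.
have [e he] := scale_invariant_homogeneous l.
apply: partial_homogeneous he _ => x; exact: differentiable_off0.
Qed.

Lemma differentiable_partial_off0 l j x : x != 0 ->
  differentiable (partial j (f l)) x.
Proof.
apply: homogeneous_differentiable (@grad_homogeneous l j) _ _ => u hu.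
by have [U [_ SU _ dU]] := f_smooth l; have [/(_ u (SU _ hu))[]] := dU j.
Qed.

Lemma differentiable_partial2_off0 l j k x : x != 0 ->
  differentiable (partial k (partial j (f l))) x.
Proof.
have hom : homogeneous (p - 1 - 1) (fun=> 0) (partial k (partial j (f l))).
  apply: partial_homogeneous (@grad_homogeneous l j) _ => y.
  exact: differentiable_partial_off0.
apply: homogeneous_differentiable hom _ _ => u hu.
have [U [_ SU _ dU]] := f_smooth l.
by have [_ /(_ k)/(_ u (SU _ hu))[]] := dU j.
Qed.

Lemma unit_ball0 : unit_ball (0 : 'cV[R]_d.+1).
Proof. by rewrite /unit_ball /= norm2E dotv0l sqrtr0. Qed.

(** Origin included, so that partial derivatives of linear combinations are identities
    between functions and can be differentiated again. *)
Lemma has_partial_everywhere l j x : has_partial j (f l) x.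
Proof.
have [->|x0] := eqVneq x 0; first by have [h _] := f_ball unit_ball0; exact: h.
exact/diff_derivable/differentiable_off0.
Qed.

Lemma has_partial2_everywhere l j k x : has_partial k (partial j (f l)) x.
Proof.
have [->|x0] := eqVneq x 0; first by have [_ [h _]] := f_ball unit_ball0; exact: (h l j k).
exact/diff_derivable/differentiable_partial_off0.
Qed.

Definition lincomb (c : 'I_n -> R) (h : 'I_n -> 'cV[R]_d.+1 -> R) x : R :=
  \sum_l c l * h l x.

Lemma partial_lincomb c h j : (forall l x, has_partial j (h l) x) ->
  partial j (lincomb c h) = lincomb c (fun l => partial j (h l)).
Proof.
move=> dh; apply/funext => x; rewrite /partial.
have -> : lincomb c h = \sum_l (c l \*: h l).
  by apply/funext => y; rewrite /lincomb fct_sumE.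
rewrite derive_sum => [|l]; last exact/derivableZ/dh.
by apply: eq_bigr => l _; rewrite deriveZ //; exact: dh.
Qed.

Lemma differentiable_lincomb c (h : 'I_n -> 'cV[R]_d.+1 -> R) x :
  (forall l, differentiable (h l) x) -> differentiable (lincomb c h) x.
Proof.
move=> dh; have -> : lincomb c h = \sum_l (c l \*: h l).
  by apply/funext => y; rewrite /lincomb fct_sumE.
by apply: differentiable_sum => l; exact: differentiableZ.
Qed.

End ScaleInvariant.

(** * Second-order expansion of the gradient at the optimum *)

Section Remainder.
Context {R : realType} {d n : nat} (f : 'I_n -> 'cV[R]_d.+1 -> R) (p : R).
Hypothesis f_scale : scale_invariant f p.
Hypothesis f_smooth : forall l, grad_C2_near_sphere (f l).
Hypothesis f_ball : derivatives_on_ball f.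
Notation F := (favg f).

Lemma favg_lincomb : F = lincomb (fun=> n%:R^-1) f.
Proof. by apply/funext => x; rewrite /favg /lincomb mulr_sumr. Qed.

Lemma partial_favg j : partial j F = lincomb (fun=> n%:R^-1) (fun l => partial j (f l)).
Proof.
rewrite favg_lincomb partial_lincomb // => l x.
exact: has_partial_everywhere f_scale f_smooth f_ball l j x.
Qed.

Lemma partial2_favg j k : partial k (partial j F) =
  lincomb (fun=> n%:R^-1) (fun l => partial k (partial j (f l))).
Proof.
rewrite partial_favg partial_lincomb // => l x.
exact: has_partial2_everywhere f_scale f_smooth f_ball l j k x.
Qed.

Lemma differentiable_partial_favg j x : x != 0 -> differentiable (partial j F) x.
Proof.
move=> x0; rewrite partial_favg; apply: differentiable_lincomb => l.
exact: differentiable_partial_off0 f_scale f_smooth l j x x0.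
Qed.

Lemma differentiable_partial2_favg j k x : x != 0 ->
  differentiable (partial k (partial j F)) x.
Proof.
move=> x0; rewrite partial2_favg; apply: differentiable_lincomb => l.
exact: differentiable_partial2_off0 f_scale f_smooth l j k x x0.
Qed.

Lemma has_partial2_favg j k x : has_partial k (partial j F) x.
Proof.
have [->|x0] := eqVneq x 0; last first.
  exact/diff_derivable/differentiable_partial_favg.
rewrite partial_favg /has_partial.
have -> : lincomb (fun=> n%:R^-1) (fun l => partial j (f l)) =
    \sum_l (n%:R^-1 \*: partial j (f l)) :> ('cV[R]_d.+1 -> R).
  by apply/funext => y; rewrite /lincomb fct_sumE.
apply: derivable_sum => l; apply: derivableZ.
exact: has_partial2_everywhere f_scale f_smooth f_ball l j k 0.
Qed.

Lemma has_partial3_favg j k i x : has_partial i (partial k (partial j F)) x.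
Proof.
have [->|x0] := eqVneq x 0.
  by have [_ [_ h]] := f_ball unit_ball0; exact: h.
exact/diff_derivable/differentiable_partial2_favg.
Qed.

(** Taylor's formula for the single scalar function t |-> z . grad F (x + t w), so
    that all third derivatives are taken at one common point. *)
Lemma taylor_grad_favg x w z : (forall t : R, t \in `[0, 1] -> x + t *: w != 0) ->
  exists2 c : R, c \in `]0, 1[ &
    dotv z (grad F (x + w)) = dotv z (grad F x) + dotv z (hess F x *m w)
      + (\sum_j z j 0 * dotv w (Hmx f j (x + c *: w) *m w)) / 2.
Proof.
move=> off0.
pose h := lincomb (fun j => z j 0) (fun j => partial j F).
have hk k : partial k h = lincomb (fun j => z j 0) (fun j => partial k (partial j F)).
  by rewrite /h partial_lincomb // => j y; exact: has_partial2_favg.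
pose h2 := lincomb (fun k => w k 0) (fun k => partial k h).
have h2i i : partial i h2 = lincomb (fun k => w k 0) (fun k =>
    lincomb (fun j => z j 0) (fun j => partial i (partial k (partial j F)))).
  rewrite /h2 partial_lincomb => [|k y].
    congr lincomb; apply/funext => k; rewrite hk partial_lincomb // => j y.
    exact: has_partial3_favg.
  rewrite hk /has_partial.
  have -> : lincomb (fun j => z j 0) (fun j => partial k (partial j F)) =
      \sum_j (z j 0 \*: partial k (partial j F)).
    by apply/funext => u; rewrite /lincomb fct_sumE.
  by apply: derivable_sum => j; apply: derivableZ; exact: has_partial3_favg.
have dh y : y != 0 -> differentiable h y.
  move=> y0; apply: differentiable_lincomb => j.
  exact: differentiable_partial_favg.
have dh2 y : y != 0 -> differentiable h2 y.
  move=> y0; apply: differentiable_lincomb => k; rewrite hk.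
  by apply: differentiable_lincomb => j; exact: differentiable_partial2_favg.
have [c c01] := @taylor2 R (fun t => h (x + t *: w)) (fun t => h2 (x + t *: w))
    (fun t => \sum_i w i 0 * partial i h2 (x + t *: w))
  (fun t t01 => is_derive_line (dh _ (off0 t t01)))
  (fun t t01 => is_derive_line (dh2 _ (off0 t t01))).
rewrite scale1r scale0r addr0 => e; exists c => //.
have gradE y : dotv z (grad F y) = h y.
  by apply: eq_bigr => j _; rewrite mxE.
rewrite !gradE e; congr (_ + _ + _ / _).
- rewrite /h2 /lincomb /dotv.
  under eq_bigr => k _ do rewrite hk /lincomb mulr_sumr.
  rewrite exchange_big; apply: eq_bigr => j _; rewrite mxE mulr_sumr.
  by apply: eq_bigr => k _; rewrite !mxE; ring.
- under eq_bigr => i _ do rewrite h2i /lincomb mulr_sumr.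
  under [RHS]eq_bigr => j _ do rewrite /dotv mulr_sumr.
  transitivity (\sum_i \sum_k \sum_j z j 0 * (w k 0 *
      (partial i (partial k (partial j F)) (x + c *: w) * w i 0))).
    apply: eq_bigr => i _; apply: eq_bigr => k _; rewrite !mulr_sumr.
    by apply: eq_bigr => j _; ring.
  rewrite exchange_big /= [RHS]exchange_big /=; apply: eq_bigr => k _.
  rewrite exchange_big /=; apply: eq_bigr => j _.
  rewrite mxE !mulr_sumr; apply: eq_bigr => i _.
  by rewrite !mxE.
Qed.

Variables (xs : 'cV[R]_d.+1) (lams : R).
Variables (lam : 'I_d.+1 -> R) (v : 'I_d.+1 -> 'cV[R]_d.+1) (M1 : R).
Hypothesis xs_sphere : unit_sphere xs.
Hypothesis xs_grad : grad (favg f) xs = lams *: xs.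
Hypothesis v_eigen : forall i, hess (favg f) xs *m v i = lam i *: v i.
Hypothesis v_orthonormal : forall i j, dotv (v i) (v j) = (i == j)%:R.
Hypothesis v_first : v ord0 = xs.
Hypothesis hM1 : is_max (M1_values f lams lam v) M1.

(** Diagonal of the linearised dynamics: lams replaces the eigenvalue lam ord0 along
    the optimum. *)
Definition rate i := if i == ord0 then lams else lam i.

(** From 2 r c <= r^2 + c^2; it replaces an application of Cauchy-Schwarz that would
    require dividing by the norm of r. *)
Lemma sum_sqr_le_of_dot (I : finType) (r c : I -> R) :
  \sum_i r i ^+ 2 = \sum_i r i * c i -> \sum_i r i ^+ 2 <= \sum_i c i ^+ 2.
Proof.
move=> e; suff : 2 * (\sum_i r i ^+ 2) <= \sum_i r i ^+ 2 + \sum_i c i ^+ 2 by lra.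
rewrite {1}e mulr_sumr -big_split; apply: ler_sum => i _ /=.
by have := sqr_ge0 (r i - c i); rewrite sqrrB; lra.
Qed.

Lemma M1_ge0 : 0 <= M1.
Proof. by have [[x [y [_ _ ->]]] _] := hM1; exact: sqrtr_ge0. Qed.

(** The quadratic forms are homogeneous of degree 2, and M1 bounds them on the sphere. *)
Lemma M1_bound w y : (forall i, unit_ball (y i)) ->
  \sum_i dotv w (Fmx f lams lam v i y *m w) ^+ 2 <= (M1 * dotv w w) ^+ 2.
Proof.
move=> hy; have [->|w0] := eqVneq w 0.
  rewrite dotv0l mulr0 expr0n big1 // => i _; by rewrite dotv0l expr0n.
have [x hx wE] : exists2 x, unit_sphere x & w = norm2 w *: x.
  exists ((norm2 w)^-1 *: w); first exact: sphere_normalize.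
  by rewrite scalerA mulfV ?scale1r ?norm2_eq0.
have [_ /(_ _ (ex_intro _ x (ex_intro _ y (And3 hx hy erefl))))] := hM1.
set q := \sum_i _ => hq.
have -> : \sum_i dotv w (Fmx f lams lam v i y *m w) ^+ 2 = dotv w w ^+ 2 * q.
  rewrite mulr_sumr; apply: eq_bigr => i _; rewrite wE -scalemxAr !dotvZl !dotvZr.
  by rewrite sphere_dotv //; ring.
rewrite exprMn mulrC ler_wpM2r ?sqr_ge0 // -(@sqr_sqrtr _ q).
  by rewrite ler_pXn2r ?nnegrE ?sqrtr_ge0 // M1_ge0.
by apply: sumr_ge0 => i _; exact: sqr_ge0.
Qed.

(** The coordinates r i of the remainder are themselves used as the weights of the
    scalar Taylor formula, z = sum_i r i v i.  Then sum_i (r i)^2 = sum_i r i b i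
    with b i = w . F_i w / 2, whence the bound by sum_i (b i)^2.  The term in
    lams - lam ord0 of F_1 comes from 1 - u . xs = |u - xs|^2 / 2. *)
Lemma grad_remainder u : unit_sphere u -> 0 < dotv u xs ->
  \sum_i (dotv (v i) (grad F u) - rate i * dotv (v i) u) ^+ 2
  <= (M1 * (1 - dotv u xs)) ^+ 2.
Proof.
move=> hu ua; set r := fun i => dotv (v i) (grad F u) - rate i * dotv (v i) u.
pose z := \sum_i r i *: v i; pose w := u - xs.
have uu := sphere_dotv hu; have xx := sphere_dotv xs_sphere.
have ww : dotv w w = 2 * (1 - dotv u xs).
  by rewrite /w !(dotvDl, dotvDr, dotvNl, dotvNr) (dotvC xs u) uu xx; ring.
have off0 (t : R) : t \in `[0, 1] -> xs + t *: w != 0.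
  rewrite in_itv => /andP[t0 t1].
  suff : 0 < dotv (xs + t *: w) xs.
    by apply: contraTneq => ->; rewrite dotv0l ltxx.
  rewrite dotvDl dotvZl /w dotvDl dotvNl xx.
  have := mulr_ge0 t0 (ltW ua); have [->|tn1] := eqVneq t 1; first by lra.
  have : t < 1 by rewrite lt_neqAle tn1.
  by lra.
have [c c01 e] := taylor_grad_favg z off0.
pose xi := xs + c *: w.
have xi_ball (i : 'I_d.+1) : unit_ball xi.
  apply: ball_segment; rewrite /unit_ball /=.
  - by rewrite (xs_sphere : norm2 xs = 1).
  - by rewrite (hu : norm2 u = 1).
  - by have := subset_itv_oo_cc c01; rewrite in_itv.
pose b i := dotv w (Fmx f lams lam v i (fun=> xi) *m w) / 2.
have rb : \sum_i r i ^+ 2 = \sum_i r i * b i.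
  have zv y : dotv z y = \sum_i r i * dotv (v i) y.
    by rewrite dotv_suml; apply: eq_bigr => i _; rewrite dotvZl.
  have hw : hess F xs *m w = \sum_k (lam k * dotv w (v k)) *: v k.
    rewrite [in LHS](orthonormal_expand v_orthonormal w) mulmx_sumr.
    by apply: eq_bigr => k _; rewrite -scalemxAr v_eigen scalerA mulrC.
  have zH : dotv z (hess F xs *m w) = \sum_i r i * (lam i * dotv w (v i)).
    rewrite hw zv; apply: eq_bigr => i _; congr (_ * _).
    by rewrite dotvC (dotv_basis v_orthonormal).
  have zg : dotv z (grad F xs) = r ord0 * lams.
    by rewrite xs_grad dotvZr -v_first (dotv_basis v_orthonormal) mulrC.
  have zHj : \sum_j z j 0 * dotv w (Hmx f j xi *m w) =
      \sum_i r i * \sum_j v i j 0 * dotv w (Hmx f j xi *m w).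
    under [RHS]eq_bigr => i _ do rewrite mulr_sumr.
    rewrite exchange_big; apply: eq_bigr => j _; rewrite summxE mulr_suml.
    by apply: eq_bigr => i _; rewrite mxE mulrA.
  have ux : xs + w = u by rewrite /w addrC subrK.
  move: e; rewrite ux zv zg zH zHj => e.
  have bE i : b i = (if i == ord0 then (lams - lam ord0) * (1 - dotv u xs) else 0)
      + (\sum_j v i j 0 * dotv w (Hmx f j xi *m w)) / 2.
    rewrite /b /Fmx mulmxDl dotvDr mulmx_suml dotv_sumr mulrDl; congr (_ + _ / 2).
      case: ifP => _; last by rewrite mul0mx dotv0r mul0r.
      by rewrite mul_scalar_mx dotvZr ww; field.
    by apply: eq_bigr => j _; rewrite -scalemxAl dotvZr.
  have -> : \sum_i r i ^+ 2 = \sum_i r i * dotv (v i) (grad F u)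
      - \sum_i r i * (rate i * dotv (v i) u).
    by rewrite -sumrB; apply: eq_bigr => i _; rewrite -mulrBr -expr2.
  rewrite e; under [RHS]eq_bigr => i _ do rewrite bE mulrDr mulrA.
  rewrite [RHS]big_split /= -mulr_suml.
  rewrite [X in _ = X + _](bigD1 ord0) //= [X in _ = _ + X + _]big1 ?addr0; last first.
    by move=> i /negPf ->; rewrite mulr0.
  have vw i : dotv w (v i) = dotv (v i) u - (i == ord0)%:R.
    by rewrite /w dotvDl dotvNl (dotvC u) -v_first v_orthonormal eq_sym.
  rewrite (bigD1 ord0) //= [X in _ - X = _](bigD1 ord0) //=.
  rewrite vw /rate eqxx v_first (dotvC xs u) /=.
  have -> : \sum_(i | i != ord0) r i * (lam i * dotv w (v i)) =
      \sum_(i | i != ord0) r i * ((if i == ord0 then lams else lam i) * dotv (v i) u).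
    by apply: eq_bigr => i /negPf i0; rewrite vw i0 subr0.
  by set X := \sum_(i | _) _; set Y := \sum_i _; rewrite /= ; lra.
apply: le_trans (sum_sqr_le_of_dot rb) _.
have -> : \sum_i b i ^+ 2 =
    (\sum_i dotv w (Fmx f lams lam v i (fun=> xi) *m w) ^+ 2) / 4.
  by rewrite mulr_suml; apply: eq_bigr => i _; rewrite /b; field.
have := M1_bound w xi_ball; rewrite ww !exprMn; lra.
Qed.

End Remainder.

(** * The noise of a variance-reduced step *)

Lemma is_derive_bigsum {R : realType} {V : normedModType R} (I : finType) (P : pred I)
    (h : I -> V -> R) (dh : I -> R) (x w : V) :
  (forall i, P i -> is_derive x w (h i) (dh i)) ->
  is_derive x w (fun y => \sum_(i | P i) h i y) (\sum_(i | P i) dh i).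
Proof.
move=> hd; have -> : (fun y => \sum_(i | P i) h i y) = \sum_(i | P i) h i.
  by apply/funext => y; rewrite fct_sumE.
apply: (big_ind2 (fun g s => is_derive x w g s)) => //.
- exact: is_derive_cst.
- by move=> f1 s1 f2 s2 h1 h2; exact: is_deriveD.
Qed.

Lemma double_dotv_le {R : realType} {d} (a b : 'cV[R]_d.+1) :
  2 * dotv a b <= dotv a a + dotv b b.
Proof.
have := dotv_ge0 (a - b).
by rewrite dotvDl !dotvDr !dotvNl !dotvNr (dotvC b a); lra.
Qed.

Section Noise.
Context {R : realType} {d n : nat} (f : 'I_n -> 'cV[R]_d.+1 -> R) (p : R).
Hypothesis f_scale : scale_invariant f p.
Hypothesis f_smooth : forall l, grad_C2_near_sphere (f l).
Hypothesis f_ball : derivatives_on_ball f.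
Notation F := (favg f).
Implicit Types (S : {set 'I_n}) (x y : 'cV[R]_d.+1).

Definition batch_coef S l : R := #|S|%:R^-1 * (l \in S)%:R - n%:R^-1.

Definition gdiff S x : R := fbatch f S x - favg f x.

Lemma gdiff_lincomb S : gdiff S = lincomb (batch_coef S) f.
Proof.
apply/funext => x; rewrite /gdiff /fbatch /favg /lincomb !mulr_sumr big_mkcond /=.
rewrite -sumrB; apply: eq_bigr => l _; rewrite /batch_coef mulrBl.
by case: ifP => _; rewrite ?mulr1 // mulr0 mul0r.
Qed.

Lemma partial_gdiff S j :
  partial j (gdiff S) = lincomb (batch_coef S) (fun l => partial j (f l)).
Proof.
rewrite gdiff_lincomb partial_lincomb // => l x.
exact: has_partial_everywhere f_scale f_smooth f_ball l j x.
Qed.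

Lemma differentiable_partial_gdiff S j x : x != 0 ->
  differentiable (partial j (gdiff S)) x.
Proof.
move=> x0; rewrite partial_gdiff; apply: differentiable_lincomb => l.
exact: differentiable_partial_off0 f_scale f_smooth l j x x0.
Qed.

Lemma Gmx_coef S (y : 'I_d.+1 -> 'cV[R]_d.+1) j k : Gmx f S y j k =
  \sum_l batch_coef S l * partial k (partial j (f l)) (y j).
Proof.
rewrite !mxE -[partial j _]/(partial j (gdiff S)) partial_gdiff partial_lincomb //.
by move=> l x; exact: has_partial2_everywhere f_scale f_smooth f_ball l j k x.
Qed.

(** The mean value theorem for phi t = sum_S N S . grad (gdiff S) (y + t w), whose
    increment is sum_S |N S|^2 because the N S are the increments of the gradients.
    One scalar function gives one point xi for all batches. *)
Lemma noise_mvt (P : {set {set 'I_n}}) (y w : 'cV[R]_d.+1) :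
  unit_ball y -> unit_ball (y + w) ->
  (forall t : R, t \in `[0, 1] -> y + t *: w != 0) ->
  let N S := grad (gdiff S) (y + w) - grad (gdiff S) y in
  exists2 xi : 'cV[R]_d.+1, unit_ball xi &
    \sum_(S in P) dotv (N S) (N S) <=
    \sum_(S in P) spectral_norm (Gmx f S (fun=> xi)) ^+ 2 * dotv w w.
Proof.
move=> hy hyw off0 N.
pose phi (t : R) := \sum_(S in P) \sum_j N S j 0 * partial j (gdiff S) (y + t *: w).
pose dphi (t : R) := \sum_(S in P) dotv (N S) (Gmx f S (fun=> y + t *: w) *m w).
have dp (t : R) : t \in `[0, 1] -> is_derive t 1 phi (dphi t).
  move=> t01; apply: is_derive_bigsum => S _.
  have -> : dotv (N S) (Gmx f S (fun=> y + t *: w) *m w) =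
      \sum_j N S j 0 *: \sum_k w k 0 * partial k (partial j (gdiff S)) (y + t *: w).
    apply: eq_bigr => j _; congr (_ * _); rewrite mxE; apply: eq_bigr => k _.
    by rewrite !mxE mulrC.
  apply: is_derive_bigsum => j _.
  apply: is_deriveZ; apply: is_derive_line.
  exact: differentiable_partial_gdiff (off0 t t01).
have [c c01] := mvt_unit dp; rewrite /phi scale1r scale0r addr0 => e.
exists (y + c *: w).
  have -> : w = (y + w) - y by rewrite addrC addKr.
  by apply: ball_segment => //; move: c01; rewrite in_itv.
have NN S : dotv (N S) (N S) = \sum_j N S j 0 * partial j (gdiff S) (y + w)
    - \sum_j N S j 0 * partial j (gdiff S) y.
  by rewrite -sumrB; apply: eq_bigr => j _; rewrite -mulrBr !mxE.
have e1 : \sum_(S in P) dotv (N S) (N S) = dphi c.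
  by rewrite -e -sumrB; apply: eq_bigr => S _; exact: NN.
suff : 2 * dphi c <= \sum_(S in P) dotv (N S) (N S) +
    \sum_(S in P) spectral_norm (Gmx f S (fun=> y + c *: w)) ^+ 2 * dotv w w.
  by rewrite e1; lra.
rewrite /dphi mulr_sumr -big_split; apply: ler_sum => S _ /=.
set G := Gmx f S _; apply: le_trans (double_dotv_le _ _) _.
rewrite lerD2l -!norm2_sqr -exprMn.
rewrite ler_pXn2r ?nnegrE ?norm2_ge0 ?spectral_norm_ge //.
by rewrite mulr_ge0 ?norm2_ge0 ?spectral_norm_ge0.
Qed.

(** Transposing l and l' permutes the batches. *)
Lemma batch_count_const s (l l' : 'I_n) :
  \sum_(S in batches s) ((l \in S)%:R : R) = \sum_(S in batches s) (l' \in S)%:R.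
Proof.
pose g (S : {set 'I_n}) := tperm l l' @: S.
have gK : involutive g.
  move=> S; rewrite /g -imset_comp -[RHS]imset_id; apply: eq_imset => i /=.
  by rewrite tpermK.
rewrite (reindex_inj (inv_inj gK)); apply: eq_big => S.
  by rewrite !inE card_imset //; exact: perm_inj.
by move=> _; rewrite -{1}(tpermR l l') mem_imset //; exact: perm_inj.
Qed.

(** Sampling without replacement is unbiased: by symmetry each l lies in the same
    number of batches, and double counting gives this number. *)
Lemma sum_batch_coef s l : (0 < s)%N -> \sum_(S in batches s) batch_coef S l = 0.
Proof.
move=> s0; have n0 : (0 < n)%N by apply: leq_ltn_trans (ltn_ord l).
have nR : n%:R != 0 :> R by rewrite pnatr_eq0 -lt0n.
have sR : s%:R != 0 :> R by rewrite pnatr_eq0 -lt0n.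
pose N := \sum_(S in batches s) ((l \in S)%:R : R).
have dc : n%:R * N = s%:R * #|batches (n := n) s|%:R.
  have -> : n%:R * N = \sum_(l' < n) N.
    by rewrite sumr_const card_ord mulr_natl.
  transitivity (\sum_(l' < n) \sum_(S in batches s) ((l' \in S)%:R : R)).
    by apply: eq_bigr => l' _; exact: batch_count_const.
  rewrite exchange_big /=; transitivity (\sum_(S in batches (n := n) s) (s%:R : R)).
    apply: eq_bigr => S; rewrite inE => /eqP <-.
    rewrite -sum1_card natr_sum [RHS]big_mkcond /=.
    by apply: eq_bigr => i _; case: ifP.
  by rewrite sumr_const mulr_natr.
rewrite /batch_coef sumrB sumr_const.
have -> : \sum_(S in batches s) #|S|%:R^-1 * (l \in S)%:R = s%:R^-1 * N.
  rewrite mulr_sumr; apply: eq_bigr => S; rewrite inE => /eqP ->; by [].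
rewrite -[X in _ - X]mulr_natr; apply: (mulfI nR); apply: (mulfI sR).
rewrite !mulr0; apply/eqP; rewrite -subr_eq0 subr0; apply/eqP.
transitivity (n%:R * N - s%:R * #|batches (n := n) s|%:R : R); last by rewrite dc subrr.
by field; rewrite nR sR.
Qed.

(** The control variate evaluates the gradient at the reference point, rescaled by
    the factor alpha.  By homogeneity this is the gradient at the projection of x on
    the line of y; here both points are divided by |x| to bring them into the unit
    ball. *)
Definition noise y x S : 'cV[R]_d.+1 :=
  norm2 x *: (grad (gdiff S) ((norm2 x)^-1 *: x)
    - grad (gdiff S) ((dotv x y / dotv y y / norm2 x) *: y)).

Lemma sum_noise s y x : (0 < s)%N -> \sum_(S in batches s) noise y x S = 0.
Proof.
move=> s0; rewrite /noise -scaler_sumr sumrB.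
suff g0 z : \sum_(S in batches s) grad (gdiff S) z = 0.
  by rewrite !g0 subr0 scaler0.
apply/matrixP => j k; rewrite summxE mxE.
under eq_bigr => S _ do rewrite mxE partial_gdiff /lincomb.
rewrite exchange_big /= big1 // => l _.
by rewrite -mulr_suml sum_batch_coef ?mul0r.
Qed.

(** The mean value theorem between the two points of [noise].  Their distance, times
    |x|, is the distance of x to its projection on y, so at most its distance to any
    c y.  The segment avoids the origin because x . y > 0. *)
Lemma noise_energy (P : {set {set 'I_n}}) (y x : 'cV[R]_d.+1) c :
  0 < dotv x y ->
  exists2 xi : 'cV[R]_d.+1, unit_ball xi &
    \sum_(S in P) dotv (noise y x S) (noise y x S) <=
    \sum_(S in P) spectral_norm (Gmx f S (fun=> xi)) ^+ 2
      * dotv (x - c *: y) (x - c *: y).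
Proof.
move=> xy.
have x0 : x != 0 by apply: contraTneq xy => ->; rewrite dotv0l ltxx.
have y0 : y != 0 by apply: contraTneq xy => ->; rewrite dotv0r ltxx.
have nx : 0 < norm2 x by rewrite norm2_gt0.
have ny : 0 < norm2 y by rewrite norm2_gt0.
have yy : 0 < dotv y y by rewrite -norm2_sqr exprn_gt0.
set k := dotv x y / dotv y y; have k0 : 0 < k by rewrite divr_gt0.
pose u := (norm2 x)^-1 *: x; pose y' := (k / norm2 x) *: y.
have hu : unit_ball u by rewrite /unit_ball /= (sphere_normalize x0 : norm2 u = 1).
have hy' : unit_ball y'.
  rewrite /unit_ball /= norm2Z ger0_norm; last exact/ltW/divr_gt0.
  rewrite mulrAC ler_pdivrMr //.
  rewrite mul1r -(ler_pM2r ny) -mulrA -expr2 norm2_sqr /k divfK ?gt_eqF //.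
  exact: dotv_le.
have uy' : y' + (u - y') = u by rewrite addrC subrK.
have off0 (t : R) : t \in `[0, 1] -> y' + t *: (u - y') != 0.
  rewrite in_itv => /andP[t0 t1].
  suff : 0 < dotv (y' + t *: (u - y')) y.
    by apply: contraTneq => ->; rewrite dotv0l ltxx.
  have seg (a b : 'cV[R]_d.+1) :
      dotv (a + t *: (b - a)) y = (1 - t) * dotv a y + t * dotv b y.
    by rewrite dotvDl dotvZl dotvDl dotvNl; ring.
  rewrite seg; have uy0 : 0 < dotv u y by rewrite dotvZl mulr_gt0 ?invr_gt0.
  have y'y0 : 0 < dotv y' y by rewrite dotvZl mulr_gt0 ?divr_gt0.
  have [->|tn1] := eqVneq t 1; first by lra.
  have t1' : 0 < 1 - t by rewrite subr_gt0 lt_neqAle tn1.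
  have h1 := mulr_ge0 t0 (ltW uy0); have h2 := mulr_gt0 t1' y'y0; lra.
have huy' : unit_ball (y' + (u - y')) by rewrite uy'.
have [xi hxi] := noise_mvt P hy' huy' off0.
rewrite /= uy' => e; exists xi => //.
have dn S : dotv (noise y x S) (noise y x S) = dotv x x *
    dotv (grad (gdiff S) u - grad (gdiff S) y') (grad (gdiff S) u - grad (gdiff S) y').
  by rewrite /noise -/k -/u -/y' dotvZl dotvZr mulrA -expr2 norm2_sqr.
under eq_bigr => S _ do rewrite dn.
rewrite -mulr_sumr; apply: le_trans (ler_wpM2l (dotv_ge0 x) e) _.
rewrite mulr_sumr; apply: ler_sum => S _; rewrite mulrCA ler_wpM2l ?sqr_ge0 //.
have -> : dotv x x * dotv (u - y') (u - y') = dotv (x - k *: y) (x - k *: y).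
  have -> : x - k *: y = norm2 x *: (u - y').
    rewrite scalerBr /u /y' !scalerA mulfV ?gt_eqF // scale1r; congr (_ - _ *: _).
    by field; exact: lt0r_neq0.
  by rewrite dotvZl dotvZr mulrA -expr2 norm2_sqr.
have ck := sqr_ge0 (c - k); have := mulr_ge0 ck (ltW yy).
have ek : k * dotv y y = dotv x y by rewrite /k divfK ?gt_eqF.
rewrite !(dotvDl, dotvDr, dotvNl, dotvNr, dotvZl, dotvZr) (dotvC y x) -ek.
by rewrite sqrrB !expr2; lra.
Qed.

End Noise.

(** * Decomposition of one step *)

Section OneStep.
Context {R : realType} {d n : nat} (f : 'I_n -> 'cV[R]_d.+1 -> R) (p : R).
Hypothesis f_scale : scale_invariant f p.
Hypothesis f_smooth : forall l, grad_C2_near_sphere (f l).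
Hypothesis f_ball : derivatives_on_ball f.
Notation F := (favg f).
Implicit Types (S : {set 'I_n}) (x y : 'cV[R]_d.+1).

Lemma partial_favgE j x : partial j F x = n%:R^-1 * \sum_l partial j (f l) x.
Proof. by rewrite (partial_favg f_scale f_smooth f_ball) /lincomb mulr_sumr. Qed.

Lemma partial_gdiffE S j x : partial j (gdiff f S) x =
  #|S|%:R^-1 * \sum_(l in S) partial j (f l) x - partial j F x.
Proof.
rewrite (partial_gdiff f_scale f_smooth f_ball) partial_favgE.
rewrite /lincomb !mulr_sumr [in X in _ = X - _]big_mkcond /= -sumrB.
apply: eq_bigr => l _; rewrite /batch_coef mulrBl.
by case: ifP => _; rewrite ?mulr1 // mulr0 mul0r.
Qed.

(** The factor alpha is k^(p - 1) with k = x.y / |y|^2, hence alpha grad f_l y is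
    grad f_l (k y); all gradients then scale by |x|^(p - 1). *)
Lemma vr_step_decomp eta s y x S : (0 < s)%N -> S \in batches s -> 0 < dotv x y ->
  vr_step f p eta s y x S = (1 - eta) *: x +
    eta *: (norm2 x *: grad F ((norm2 x)^-1 *: x) + noise f y x S).
Proof.
move=> s0; rewrite inE => /eqP Ss xy.
have x0 : x != 0 by apply: contraTneq xy => ->; rewrite dotv0l ltxx.
have y0 : y != 0 by apply: contraTneq xy => ->; rewrite dotv0r ltxx.
have nx : 0 < norm2 x by rewrite norm2_gt0.
have ny : 0 < norm2 y by rewrite norm2_gt0.
have yy : 0 < dotv y y by rewrite -norm2_sqr exprn_gt0.
set k := dotv x y / dotv y y; have k0 : 0 < k by rewrite divr_gt0.
have ux0 : (norm2 x)^-1 *: x != 0.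
  by rewrite scaler_eq0 negb_or x0 andbT invr_eq0 gt_eqF.
have y'0 : (k / norm2 x) *: y != 0.
  by rewrite scaler_eq0 negb_or y0 andbT gt_eqF // divr_gt0.
have alphaE : vr_alpha p y x = k `^ (p - 1).
  rewrite /vr_alpha gtr0_norm // powRrM powR_mulrn ?norm2_ge0 // norm2_sqr.
  rewrite /k powRM ?invr_ge0 ?ltW //; congr (_ * _).
  by rewrite -[in RHS]powR_inv1 ?ltW // -powRrM mulN1r powRN.
pose nn := norm2 x `^ (p - 1).
have gx l j : partial j (f l) x = nn * partial j (f l) ((norm2 x)^-1 *: x).
  rewrite -[in LHS](scale1r x) -(mulfV (lt0r_neq0 nx)) -scalerA.
  by rewrite (grad_homogeneous f_scale f_smooth) // addr0.
have gy l j : k `^ (p - 1) * partial j (f l) y =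
    nn * partial j (f l) ((k / norm2 x) *: y).
  transitivity (partial j (f l) (k *: y)).
    by rewrite (grad_homogeneous f_scale f_smooth) // addr0.
  have -> : k *: y = norm2 x *: ((k / norm2 x) *: y).
    by rewrite scalerA mulrCA mulfV ?mulr1 // gt_eqF.
  by rewrite (grad_homogeneous f_scale f_smooth) // addr0.
have gF j : k `^ (p - 1) * partial j F y = nn * partial j F ((k / norm2 x) *: y).
  rewrite !partial_favgE mulrCA mulr_sumr.
  by rewrite (eq_bigr _ (fun l _ => gy l j)) -mulr_sumr mulrCA.
have q0 : norm2 x `^ (p - 2) != 0 by rewrite gt_eqF // powR_gt0.
have nnE : nn = norm2 x `^ (p - 2) * norm2 x.
  rewrite /nn -[X in _ * X]powRr1 ?norm2_ge0 // -powRD ?(gt_eqF nx) ?implybT //.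
  by congr (_ `^ _); ring.
rewrite /vr_step; congr (_ + _ *: _).
apply/matrixP => j i; rewrite !mxE.
rewrite !partial_gdiffE Ss alphaE summxE.
under eq_bigr => l _ do rewrite !mxE gx gy -mulrBr.
rewrite -mulr_sumr sumrB gF nnE -/k.
by field; rewrite q0 andbT pnatr_eq0 -lt0n.
Qed.

Lemma noise_L L s y x c S : is_max (L_values f s) L -> S \in batches s ->
  0 < dotv x y ->
  dotv (noise f y x S) (noise f y x S) <= L * dotv (x - c *: y) (x - c *: y).
Proof.
move=> [_ hL] hS xy.
have [xi hxi] := noise_energy f_scale f_smooth f_ball [set S] c xy.
rewrite !big_set1 => /le_trans; apply; rewrite ler_wpM2r ?dotv_ge0 //.
by apply: hL; exists S, (fun=> xi).
Qed.

Lemma noise_K K s y x c : is_max (K_values f s) K -> 0 < dotv x y ->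
  Ebatch s (fun S => dotv (noise f y x S) (noise f y x S))
  <= K * dotv (x - c *: y) (x - c *: y).
Proof.
move=> [_ hK] xy.
have [xi hxi e] := noise_energy f_scale f_smooth f_ball (batches s) c xy.
have := hK _ (ex_intro _ (fun=> xi) (conj (fun=> hxi) erefl)).
move=> /(ler_wpM2r (dotv_ge0 (x - c *: y))); apply: le_trans.
by rewrite /Ebatch -mulrA ler_wpM2l ?invr_ge0 ?ler0n // mulr_suml.
Qed.

(** The matrix of a batch is the average of the matrices of its singletons. *)
Lemma L_max_mono s L L0 : (0 < s)%N -> is_max (L_values f s) L ->
  is_max (L_values f 1) L0 -> L <= L0.
Proof.
move=> s0 [[S [y [hS hy ->]]] _] [_ hL0].
have L0l l : spectral_norm (Gmx f [set l]%SET y) ^+ 2 <= L0.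
  by apply: hL0; exists [set l]%SET, y; split => //; rewrite inE cards1.
move: hS; rewrite inE => /eqP Ss.
have sR : s%:R != 0 :> R by rewrite pnatr_eq0 -lt0n.
have GE : Gmx f S y = s%:R^-1 *: \sum_(l in S) Gmx f [set l]%SET y.
  apply/matrixP => j k; rewrite (Gmx_coef f_scale f_smooth f_ball) [RHS]mxE summxE.
  under [in RHS]eq_bigr => l _ do rewrite (Gmx_coef f_scale f_smooth f_ball).
  rewrite exchange_big mulr_sumr; apply: eq_bigr => l' _ /=.
  rewrite -mulr_suml mulrA; congr (_ * _).
  rewrite /batch_coef sumrB sumr_const Ss mulrBr.
  have -> : s%:R^-1 * (n%:R^-1 *+ s) = n%:R^-1 :> R by rewrite -(mulr_natl n%:R^-1 s) mulKf.
  congr (_ * _ - _); under eq_bigr => l _ do rewrite cards1 invr1 mul1r inE.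
  rewrite big_mkcond /= (bigD1 l') //= eqxx big1 ?addr0 => [|l ll'].
    by case: ifP.
  by rewrite eq_sym (negPf ll') if_same.
have L00 : 0 <= L0.
  have [l lS] : exists l, l \in S by apply/card_gt0P; rewrite Ss.
  exact: le_trans (sqr_ge0 _) (L0l l).
rewrite -(@sqr_sqrtr _ L0) // ler_pXn2r ?nnegrE ?spectral_norm_ge0 ?sqrtr_ge0 //.
apply: spectral_norm_le => x hx.
rewrite GE -scalemxAl norm2Z ger0_norm ?invr_ge0 // mulmx_suml.
rewrite mulrC ler_pdivrMr ?ltr0n //; apply: le_trans (norm2_sum _ _ _) _.
rewrite -Ss mulr_natr -sumr_const; apply: ler_sum => l _.
apply: le_trans (spectral_norm_ge _ _) _; rewrite (hx : norm2 x = 1) mulr1.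
rewrite -(@ler_pXn2r _ 2) ?nnegrE ?spectral_norm_ge0 ?sqrtr_ge0 //.
by rewrite sqr_sqrtr.
Qed.

End OneStep.

(** * Cones around the optimum *)

Lemma le_of_sqr {R : realDomainType} (a b : R) :
  0 <= a -> 0 <= b -> a ^+ 2 <= b ^+ 2 -> a <= b.
Proof. by move=> a0 b0; rewrite ler_pXn2r ?nnegrE. Qed.

Lemma sqr_le_of {R : realDomainType} (a b : R) :
  0 <= a -> a <= b -> a ^+ 2 <= b ^+ 2.
Proof. by move=> a0 ab; rewrite ler_pXn2r ?nnegrE // (le_trans a0). Qed.

Section Tangent.
Context {R : realType} {d : nat} (xs : 'cV[R]_d.+1).
Hypothesis xs_sphere : unit_sphere xs.
Implicit Types x y z : 'cV[R]_d.+1.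
Notation P x := (dotv x xs).

Definition tang x : 'cV[R]_d.+1 := x - P x *: xs.

Lemma tangD x y : tang (x + y) = tang x + tang y.
Proof. by rewrite /tang dotvDl scalerDl opprD addrACA. Qed.

Lemma tangZ c x : tang (c *: x) = c *: tang x.
Proof. by rewrite /tang dotvZl scalerBr scalerA. Qed.

Lemma dotv_split x y : dotv x y = P x * P y + dotv (tang x) (tang y).
Proof.
rewrite /tang !(dotvDl, dotvDr, dotvNl, dotvNr, dotvZl, dotvZr).
by rewrite (sphere_dotv xs_sphere) (dotvC xs y); ring.
Qed.

Lemma norm2_split x : norm2 x ^+ 2 = P x ^+ 2 + norm2 (tang x) ^+ 2.
Proof. by rewrite !norm2_sqr dotv_split expr2. Qed.

Lemma norm2_tang x : norm2 (tang x) <= norm2 x.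
Proof.
rewrite -(@ler_pXn2r _ 2) ?nnegrE ?norm2_ge0 // (norm2_split x).
by rewrite lerDr sqr_ge0.
Qed.

Lemma abs_P_le x : `|P x| <= norm2 x.
Proof. by have := cauchy_schwarz x xs; rewrite (xs_sphere : norm2 xs = 1) mulr1. Qed.

Lemma le_norm2_P x : P x <= norm2 x.
Proof. exact: le_trans (ler_norm _) (abs_P_le x). Qed.

Lemma dist_tang x y : P x != 0 -> P y != 0 ->
  x - (P x / P y) *: y = tang x - (P x / P y) *: tang y.
Proof.
by move=> x0 y0; rewrite /tang scalerBr scalerA divfK // opprB addrA subrK.
Qed.

(** Scale-free position of x: its norm is the tangent of the angle to xs. *)
Definition slope x : 'cV[R]_d.+1 := (P x)^-1 *: tang x.

Lemma dist_slope x y : P x != 0 -> P y != 0 ->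
  x - (P x / P y) *: y = P x *: (slope x - slope y).
Proof.
move=> x0 y0; rewrite dist_tang // /slope [RHS]scalerBr !scalerA mulfV //.
by rewrite scale1r.
Qed.

Lemma slope_le x t : 0 < P x -> (norm2 (slope x) <= t) = (norm2 (tang x) <= t * P x).
Proof.
by move=> x0; rewrite /slope norm2Z gtr0_norm ?invr_gt0 // mulrC ler_pdivrMr.
Qed.

(** For 0 <= D < 1, the nonzero vectors at angle at most arccos (1 - D) from xs. *)
Definition cone D x := 0 < P x /\ (1 - D) * norm2 x <= P x.

(** The bound on D makes the angle at most pi / 4. *)
Lemma cone_tang D x : 0 <= D -> D <= 1 - (Num.sqrt 2)^-1 -> cone D x ->
  norm2 (tang x) <= P x.
Proof.
move=> D0 D1 [x0 hx]; apply: le_of_sqr (norm2_ge0 _) (ltW x0) _.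
have s2 : (Num.sqrt 2)^-1 ^+ 2 = 2^-1 :> R by rewrite exprVn sqr_sqrtr.
have s20 : 0 <= (Num.sqrt 2)^-1 * norm2 x.
  by rewrite mulr_ge0 ?norm2_ge0 // invr_ge0 sqrtr_ge0.
have : (Num.sqrt 2)^-1 * norm2 x <= P x.
  by apply: le_trans hx; rewrite ler_wpM2r ?norm2_ge0 //; lra.
by move/(sqr_le_of s20); rewrite exprMn s2 (norm2_split x); lra.
Qed.

(** |tang x|^2 = (|x| - P x) (|x| + P x), and the cone gives
    |x| - P x <= D |x| <= D (|x| + P x). *)
Lemma cone_gap D x : 0 <= D -> cone D x ->
  norm2 x - P x <= Num.sqrt D * norm2 (tang x).
Proof.
move=> D0 [x0 hx]; have n0 := norm2_ge0 x; have Pn := le_norm2_P x.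
apply: le_of_sqr; first by rewrite subr_ge0.
  by rewrite mulr_ge0 ?sqrtr_ge0 ?norm2_ge0.
rewrite exprMn sqr_sqrtr //.
have -> : norm2 (tang x) ^+ 2 = (norm2 x - P x) * (norm2 x + P x).
  by have := norm2_split x; lra.
rewrite expr2 mulrCA; apply: ler_wpM2l; first by rewrite subr_ge0.
by have := mulr_ge0 D0 (ltW x0); lra.
Qed.

Lemma cone_closer D x y : 0 <= D -> D <= 1 -> cone D y -> 0 < P x ->
  norm2 (tang x) * P y <= norm2 (tang y) * P x -> cone D x.
Proof.
move=> D0 D1 [y0 hy] x0 hxy; split => //.
have D1' : 0 <= 1 - D by rewrite subr_ge0.
have t0 : 0 <= norm2 (tang x) * P y by rewrite mulr_ge0 ?norm2_ge0 // ltW.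
apply: le_of_sqr; [by rewrite mulr_ge0 ?norm2_ge0|exact: ltW|].
rewrite -(ler_pM2r (exprn_gt0 2 y0)).
move: hy => /(sqr_le_of (mulr_ge0 D1' (norm2_ge0 y))).
move: hxy => /(sqr_le_of t0); rewrite !exprMn (norm2_split x) (norm2_split y) => hxy hy.
have h1 := ler_wpM2l (sqr_ge0 (P x)) hy.
have h2 := ler_wpM2l (sqr_ge0 (1 - D)) hxy.
by move: h1 h2; lra.
Qed.

End Tangent.

(** The cross term vanishes because the c S are centred. *)
Lemma Ebatch_sqr {R : realType} {d n : nat} s (b : 'cV[R]_d.+1)
    (c : {set 'I_n} -> 'cV[R]_d.+1) (eta : R) : (s <= n)%N ->
  \sum_(S in batches s) c S = 0 ->
  Ebatch s (fun S => dotv (b + eta *: c S) (b + eta *: c S)) =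
  dotv b b + eta ^+ 2 * Ebatch s (fun S => dotv (c S) (c S)).
Proof.
move=> sn c0; have B0 : #|batches (n := n) s|%:R != 0 :> R.
  have -> : batches (n := n) s = [set A : {set 'I_n} | #|A| == s]%SET by [].
  by rewrite card_draws card_ord pnatr_eq0 -lt0n bin_gt0.
rewrite /Ebatch.
have -> : \sum_(S in batches s) dotv (b + eta *: c S) (b + eta *: c S) =
  \sum_(S in batches s) (dotv b b + (2 * eta * dotv b (c S) + eta ^+ 2 * dotv (c S) (c S))).
  apply: eq_bigr => S _; rewrite !(dotvDl, dotvDr, dotvZl, dotvZr) (dotvC (c S) b).
  by ring.
rewrite big_split /= sumr_const big_split /= -!mulr_sumr -dotv_sumr c0 dotv0r.
by rewrite mulr0 add0r -(mulr_natl (dotv b b)) mulrDr mulKf // mulrCA.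
Qed.

(** * Recursion of the moments within one epoch *)

Lemma ln2_le1 {R : realType} : ln 2 <= 1 :> R.
Proof.
by rewrite -[leRHS](expRK 1) ler_ln ?posrE ?expR_gt0 //; have := expR_ge1Dx (1 : R); lra.
Qed.

Lemma onem_exp_le {R : realType} (x : R) k : 0 <= 1 + x ->
  (1 + x) ^+ k <= expR (k%:R * x).
Proof.
move=> x0; rewrite expRM_natl; apply: lerXn2r; rewrite ?nnegrE ?expR_ge0 //.
exact: expR_ge1Dx.
Qed.

(** The ratio bp / bm contributes at most exp (ln 2) = 2 over m steps, and the noise
    at most exp (1 / 32) <= 3 / 2. *)
Lemma growth_le3 {R : realType} (bm bp kappa h : R) (m k : nat) :
  (k <= m)%N -> (0 < m)%N -> 0 < bm -> bm <= bp -> 0 <= kappa ->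
  0 <= h -> 2 * m%:R * h <= 1 -> 64 * kappa <= h * bm * bp ->
  2 * m%:R * (bp - bm) <= ln 2 * bm ->
  (bp ^+ 2 + 4 * kappa) ^+ k <= 3 * bm ^+ 2 ^+ k.
Proof.
move=> km m0 bm0 bmp k0 h0 mh hk hbp.
have mR : 0 < m%:R :> R by rewrite ltr0n.
have l0 : 0 <= ln 2 :> R by rewrite ln_ge0 // ler1n.
pose c : R := ln 2 / (2 * m%:R).
have c0 : 0 <= c by rewrite divr_ge0 // mulr_ge0 // ltW.
have bpc : bp <= bm * (1 + c).
  have : bp - bm <= c * bm.
    by rewrite /c mulrAC ler_pdivlMr ?mulr_gt0 // mulrC.
  by lra.
have s1 : bp ^+ 2 + 4 * kappa <= bm ^+ 2 * ((1 + c) ^+ 2 * (1 + h / 16)).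
  apply: (@le_trans _ _ (bp ^+ 2 * (1 + h / 16))).
    have := ler_wpM2r (le_trans (ltW bm0) bmp) (ler_wpM2l h0 bmp).
    by rewrite expr2; lra.
  rewrite mulrA -exprMn ler_wpM2r ?addr_ge0 ?divr_ge0 //.
  by rewrite ler_pXn2r ?nnegrE ?mulr_ge0 ?addr_ge0 // ltW // (lt_le_trans bm0).
apply: (@le_trans _ _ ((bm ^+ 2 * ((1 + c) ^+ 2 * (1 + h / 16))) ^+ k)).
  apply: lerXn2r => //; rewrite nnegrE.
    by rewrite addr_ge0 ?sqr_ge0 ?mulr_ge0.
  apply: mulr_ge0 (sqr_ge0 _) (mulr_ge0 (sqr_ge0 _) _).
  by rewrite addr_ge0 ?divr_ge0.
rewrite exprMn mulrC; apply: ler_wpM2r; first exact: exprn_ge0 (sqr_ge0 _).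
have kR : k%:R <= m%:R :> R by rewrite ler_nat.
have e1 : (1 + c) ^+ 2 ^+ k <= 2.
  rewrite -exprM; apply: le_trans (onem_exp_le _ _) _; first by rewrite addr_ge0.
  rewrite -[leRHS]lnK ?posrE // ler_expR /c natrM.
  rewrite mulrA ler_pdivrMr ?mulr_gt0 // mulrC ler_wpM2l //.
  by rewrite ler_wpM2l.
have e2 : (1 + h / 16) ^+ k <= 3 / 2.
  apply: le_trans (onem_exp_le _ _) _; first by rewrite addr_ge0 ?divr_ge0.
  have kh : k%:R * (h / 16) <= 1 / 32.
    by have := ler_wpM2r h0 kR; lra.
  apply: (@le_trans _ _ (expR (1 / 32))); first by rewrite ler_expR.
  rewrite -[1 / 32]opprK expRN -[leRHS]invrK lef_pV2 ?posrE ?expR_gt0 ?invr_gt0 ?divr_gt0 //.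
  by have := expR_ge1Dx (- (1 / 32) : R); lra.
rewrite exprMn; apply: (@le_trans _ _ (2 * (3 / 2))); last by lra.
by apply: ler_pM; rewrite ?exprn_ge0 ?sqr_ge0 ?addr_ge0 ?divr_ge0.
Qed.

(** In units of bm^(2k) q 0, the sequence q contracts by 1 - (93/64) h per step and
    receives at most (9/64) h, because r k stays below 3 bm^(2k) r 0.  Since k h is
    at most 1/2, this yields q k <= 1 - k h / 2. *)
Lemma epoch_recursion {R : realType} (bm bp al kappa h tau : R) (m : nat)
    (q r : nat -> R) :
  (0 < m)%N -> 0 < bm -> bm <= bp -> al = bm * (1 - h) -> 0 <= kappa ->
  0 <= h -> 2 * m%:R * h <= 1 -> 64 * kappa <= h * bm * bp ->
  2 * m%:R * (bp - bm) <= ln 2 * bm ->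
  0 <= r 0%N -> q 0%N = tau ^+ 2 * r 0%N ->
  (forall k, (k < m)%N ->
     q k.+1 <= (al ^+ 2 + 2 * kappa) * q k + 2 * kappa * (tau ^+ 2 * r k)) ->
  (forall k, (k < m)%N -> r k.+1 <= (bp ^+ 2 + 4 * kappa) * r k) ->
  q m <= (1 - m%:R * h / 2) * bm ^+ 2 ^+ m * q 0%N.
Proof.
move=> m0 bm0 bmp alE k0 h0 mh hk hbp r0 q0 qS rS.
have rk k : (k <= m)%N -> r k <= 3 * bm ^+ 2 ^+ k * r 0%N.
  move=> km; apply: (@le_trans _ _ ((bp ^+ 2 + 4 * kappa) ^+ k * r 0%N)).
    elim: k km => [|k IH] km; first by rewrite expr0 mul1r.
    apply: le_trans (rS k km) _.
    rewrite (exprS (bp ^+ 2 + 4 * kappa)) -mulrA ler_wpM2l ?(IH (ltnW km)) //.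
    by rewrite addr_ge0 ?sqr_ge0 ?mulr_ge0.
  by rewrite ler_wpM2r // (growth_le3 km m0 bm0 bmp k0 h0 mh hk hbp).
have Q0 : 0 <= q 0%N by rewrite q0 mulr_ge0 ?sqr_ge0.
have mR : 1 <= m%:R :> R by rewrite ler1n.
have hk' : kappa <= 3 / 128 * h * bm ^+ 2.
  have bpb : bp <= 3 / 2 * bm.
    have l1 : ln 2 * bm <= bm by rewrite -[leRHS]mul1r ler_wpM2r ?ln2_le1 // ltW.
    have : bp - bm <= m%:R * (bp - bm) by rewrite ler_peMl // subr_ge0.
    by lra.
  by have := ler_wpM2l (mulr_ge0 h0 (ltW bm0)) bpb; rewrite expr2; lra.
have h1 : h <= 1 / 2.
  by have : h <= m%:R * h by [rewrite ler_peMl]; lra.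
suff H k : (k <= m)%N -> q k <= (1 - k%:R * h / 2) * bm ^+ 2 ^+ k * q 0%N by exact: H.
elim: k => [|k IH] km; first by rewrite mul0r mul0r subr0 expr0 !mul1r.
have := IH (ltnW km) => {}IH.
apply: le_trans (qS k km) _.
have b20 : 0 < bm ^+ 2 by rewrite exprn_gt0.
have A : al ^+ 2 + 2 * kappa <= (1 - 93 / 64 * h) * bm ^+ 2.
  rewrite alE exprMn.
  have : (1 - h) ^+ 2 <= 1 - 3 / 2 * h.
    have : h * h <= 1 / 2 * h by rewrite ler_wpM2r.
    by rewrite sqrrB expr2; lra.
  move=> /(ler_wpM2l (ltW b20)); lra.
have A0 : 0 <= al ^+ 2 + 2 * kappa by rewrite addr_ge0 ?sqr_ge0 ?mulr_ge0.
have rkW := rk k (ltnW km).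
have [W WE] : {W | W = bm ^+ 2 ^+ k} by exists (bm ^+ 2 ^+ k).
have [z zE] : {z | z = k%:R * h} by exists (k%:R * h).
have W0 : 0 < W by rewrite WE exprn_gt0.
have z0 : 0 <= z by rewrite zE mulr_ge0.
rewrite -WE -zE in IH; rewrite -WE in rkW.
have z1 : z <= 1 / 2.
  have : k%:R <= m%:R :> R by rewrite ler_nat ltnW.
  by move=> /(ler_wpM2r h0); rewrite zE; lra.
have t1 : (al ^+ 2 + 2 * kappa) * q k <=
    (1 - 93 / 64 * h) * bm ^+ 2 * ((1 - z / 2) * W * q 0%N).
  apply: le_trans (ler_wpM2l A0 IH) _; apply: ler_wpM2r A.
  by apply: mulr_ge0 Q0; apply: mulr_ge0 (ltW W0); lra.
have t2 : 2 * kappa * (tau ^+ 2 * r k) <= 9 / 64 * h * bm ^+ 2 * (W * q 0%N).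
  have e1 := ler_wpM2l (sqr_ge0 tau) rkW.
  have e2 : tau ^+ 2 * r k <= 3 * (W * q 0%N) by rewrite q0; lra.
  apply: le_trans (ler_wpM2l (mulr_ge0 (ler0n _ 2) k0) e2) _.
  have := ler_wpM2r (mulr_ge0 (ltW W0) Q0) hk'; lra.
apply: le_trans (lerD t1 t2) _.
have -> : (1 - k.+1%:R * h / 2) * bm ^+ 2 ^+ k.+1 * q 0%N =
    (1 - z / 2 - h / 2) * (bm ^+ 2 * (W * q 0%N)).
  by rewrite (exprS (bm ^+ 2)) -WE zE -natr1; ring.
have c0 := mulr_ge0 (ltW b20) (mulr_ge0 (ltW W0) Q0).
have hz : h * (1 - z / 2) >= h * (3 / 4) by rewrite ler_wpM2l //; lra.
have : (1 - 93 / 64 * h) * (1 - z / 2) + 9 / 64 * h <= 1 - z / 2 - h / 2 by lra.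
by move/(ler_wpM2r c0); lra.
Qed.

(** * Dynamics of the algorithm *)

Lemma dotv_sub_le {R : realType} {d} (a b : 'cV[R]_d.+1) :
  dotv (a - b) (a - b) <= 2 * (dotv a a + dotv b b).
Proof.
have := dotv_ge0 (a + b).
by rewrite !(dotvDl, dotvDr, dotvNl, dotvNr) (dotvC b a); lra.
Qed.

(** Here a and b are the components of two vectors along xs and k is the inner product
    of their tangential parts; c > 0 keeps the angle between them below a right angle
    even if both make an angle pi / 4 with xs. *)
Lemma positive_after_rotation {R : realDomainType} (t a b c k : R) :
  0 <= t -> t <= 1 -> 0 < a -> 0 < b -> 0 < c ->
  - ((t * a - c * t) * (t * b)) <= k -> 0 < a * b + k.
Proof.
move=> t0 t1 a0 b0 c0 hk; apply: lt_le_trans (lerD (lexx (a * b)) hk).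
have -> : a * b - (t * a - c * t) * (t * b) = (a - t * t * a + t * t * c) * b.
  by ring.
rewrite mulr_gt0 //; have [->|tn] := eqVneq t 0; first by rewrite mul0r; lra.
have tt : t * t <= 1 by rewrite -[leRHS]mul1r; apply: ler_pM.
have tp : 0 < t * t by rewrite mulr_gt0 // lt_def tn.
by have := ler_wpM2r (ltW a0) tt; have := mulr_gt0 tp c0; lra.
Qed.

Section Dynamics.
Context {R : realType} {d n : nat} (f : 'I_n -> 'cV[R]_d.+1 -> R) (p : R).
Hypothesis f_scale : scale_invariant f p.
Hypothesis f_smooth : forall l, grad_C2_near_sphere (f l).
Hypothesis f_ball : derivatives_on_ball f.
Variables (xs : 'cV[R]_d.+1) (lams : R).
Variables (lam : 'I_d.+1 -> R) (v : 'I_d.+1 -> 'cV[R]_d.+1).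
Hypothesis xs_sphere : unit_sphere xs.
Hypothesis xs_grad : grad (favg f) xs = lams *: xs.
Hypothesis v_eigen : forall i, hess (favg f) xs *m v i = lam i *: v i.
Hypothesis v_orthonormal : forall i j, dotv (v i) (v j) = (i == j)%:R.
Hypothesis v_first : v ord0 = xs.
Variables (s : nat) (eta M1 M K L lamb D0 : R).
Hypothesis hs : (1 <= s <= n)%N.
Hypothesis eta_range : 0 < eta <= 1.
Hypothesis hM1 : is_max (M1_values f lams lam v) M1.
Hypothesis M1M : M1 <= M.
Hypothesis hK : is_max (K_values f s) K.
Hypothesis hL : is_max (L_values f s) L.
Hypothesis lamb_ge : forall k, k != ord0 -> `|lam k| <= lamb.
Hypothesis lamb0 : 0 <= lamb.
Hypothesis D0_ge0 : 0 <= D0.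
Hypothesis D0_le : D0 <= 1 - (Num.sqrt 2)^-1.

Notation F := (favg f).
Notation P x := (dotv x xs).
Notation tang := (tang xs).
Notation slope := (slope xs).
Notation cone := (cone xs D0).
Implicit Types (x y z : 'cV[R]_d.+1) (S : {set 'I_n}).
Variable mu : R.
Hypothesis muE : mu = M * Num.sqrt D0.
Notation G := (lams - lamb - 2 * mu).
Notation bm := (1 - eta + eta * (lams - mu)).
Notation bp := (1 - eta + eta * (lams + mu)).
Notation al := (1 - eta + eta * (lamb + mu)).
Hypothesis G0 : 0 < G.

Lemma M_ge0 : 0 <= M. Proof. exact: le_trans (M1_ge0 hM1) M1M. Qed.
Lemma mu_ge0 : 0 <= mu. Proof. by rewrite muE mulr_ge0 ?M_ge0 ?sqrtr_ge0. Qed.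
Lemma K_ge0 : 0 <= K.
Proof.
have [[y [_ ->]] _] := hK; rewrite mulr_ge0 ?invr_ge0 ?ler0n //.
by apply: sumr_ge0 => S _; exact: sqr_ge0.
Qed.
Lemma L_ge0 : 0 <= L.
Proof. by have [[S [y [_ _ ->]]] _] := hL; exact: sqr_ge0. Qed.

Lemma lams_gt0 : 0 < lams.
Proof. by have := mu_ge0; have := G0; have := lamb0; lra. Qed.

Lemma tang_basis x : tang x = \sum_(k | k != ord0) dotv x (v k) *: v k.
Proof.
rewrite /tang {1}(orthonormal_expand v_orthonormal x) (bigD1 ord0) //= v_first.
by rewrite addrAC subrr add0r.
Qed.

Lemma norm2_sum_basis (c : 'I_d.+1 -> R) :
  norm2 (\sum_(k | k != ord0) c k *: v k) ^+ 2 = \sum_(k | k != ord0) c k ^+ 2.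
Proof.
rewrite norm2_sqr (parseval v_orthonormal) [RHS]big_mkcond.
apply: eq_bigr => k _; rewrite big_mkcond /=.
have -> : \sum_i (if i != ord0 then c i *: v i else 0) =
    \sum_i (if i != ord0 then c i else 0) *: v i.
  by apply: eq_bigr => i _; case: ifP => // _; rewrite scale0r.
by rewrite (dotv_basis v_orthonormal); case: ifP => _; rewrite ?mulr0 // expr2.
Qed.

Lemma norm2_tang_sqr x :
  norm2 (tang x) ^+ 2 = \sum_(k | k != ord0) dotv x (v k) ^+ 2.
Proof. by rewrite tang_basis norm2_sum_basis. Qed.

Lemma norm2_scaled_tang (c : 'I_d.+1 -> R) C x : 0 <= C ->
  (forall k, k != ord0 -> `|c k| <= C) ->
  norm2 (\sum_(k | k != ord0) (c k * dotv x (v k)) *: v k) <= C * norm2 (tang x).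
Proof.
move=> C0 cC; apply: le_of_sqr; rewrite ?mulr_ge0 ?norm2_ge0 //.
rewrite exprMn norm2_tang_sqr norm2_sum_basis mulr_sumr; apply: ler_sum => k k0.
rewrite exprMn ler_wpM2r ?sqr_ge0 // -(real_normK (num_real (c k))).
exact: sqr_le_of (cC k k0).
Qed.

(** What the gradient at the direction of x adds to the diagonal map with entries
    [rate]. *)
Definition drift_rem x : 'cV[R]_d.+1 :=
  let u := (norm2 x)^-1 *: x in
  \sum_i (norm2 x * (dotv (v i) (grad F u) - rate lams lam i * dotv (v i) u)) *: v i.

Definition drift_lin x : 'cV[R]_d.+1 :=
  \sum_k ((1 - eta + eta * rate lams lam k) * dotv x (v k)) *: v k.

Lemma step_lin y x S : S \in batches s -> 0 < dotv x y ->
  vr_step f p eta s y x S = drift_lin x + eta *: (drift_rem x + noise f y x S).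
Proof.
move=> hS xy; have s0 : (0 < s)%N by case/andP: hs.
rewrite (vr_step_decomp f_scale f_smooth f_ball) // !scalerDr !addrA; congr (_ + _).
have x0 : x != 0 by apply: contraTneq xy => ->; rewrite dotv0l ltxx.
rewrite [in LHS](orthonormal_expand v_orthonormal (grad F _)).
rewrite {1}[in LHS](orthonormal_expand v_orthonormal x).
rewrite /drift_lin /drift_rem !scaler_sumr -!big_split; apply: eq_bigr => k _ /=.
rewrite !scalerA -!scalerDl; congr (_ *: _).
rewrite dotvZr (dotvC (v k) x) (dotvC (v k) (grad _ _)).
field; by rewrite norm2_eq0.
Qed.

Lemma P_drift_lin x : P (drift_lin x) = (1 - eta + eta * lams) * P x.
Proof. by rewrite -v_first (dotv_basis v_orthonormal) /rate eqxx. Qed.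

Lemma tang_drift_lin x : tang (drift_lin x) =
  \sum_(k | k != ord0) ((1 - eta + eta * lam k) * dotv x (v k)) *: v k.
Proof.
rewrite tang_basis; apply: eq_bigr => k /negPf k0.
by rewrite (dotv_basis v_orthonormal) /rate k0.
Qed.

Lemma tang_drift_lin_le x : norm2 (tang (drift_lin x)) <= (1 - eta + eta * lamb) * norm2 (tang x).
Proof.
have [e0 e1] := andP eta_range.
rewrite tang_drift_lin; apply: norm2_scaled_tang => [|k k0].
  by rewrite addr_ge0 ?subr_ge0 // mulr_ge0 // ltW.
apply: le_trans (ler_normD _ _) _; have e1' : 0 <= 1 - eta by rewrite subr_ge0.
rewrite normrM (gtr0_norm e0) (ger0_norm e1').
by rewrite lerD2l ler_wpM2l ?lamb_ge ?(ltW e0).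
Qed.

Lemma tang_drift_lin_move x : norm2 (tang (drift_lin x) - (1 - eta + eta * lams) *: tang x)
  <= eta * (lams + lamb) * norm2 (tang x).
Proof.
have [e0 e1] := andP eta_range.
have lams0 := ltW lams_gt0.
have -> : tang (drift_lin x) - (1 - eta + eta * lams) *: tang x =
  \sum_(k | k != ord0) (eta * (lam k - lams) * dotv x (v k)) *: v k.
  rewrite tang_drift_lin tang_basis scaler_sumr -sumrB; apply: eq_bigr => k _.
  by rewrite scalerA -scalerBl; congr (_ *: _); ring.
apply: norm2_scaled_tang => [|k k0].
  by rewrite mulr_ge0 ?addr_ge0 // ltW.
rewrite normrM gtr0_norm // ler_wpM2l ?(ltW e0) //.
apply: le_trans (ler_normB _ _) _; rewrite addrC (ger0_norm lams0) lerD2l.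
exact: lamb_ge.
Qed.

Lemma drift_rem_le x : cone x -> norm2 (drift_rem x) <= mu * norm2 (tang x).
Proof.
move=> hx; have [x0 _] := hx.
have xn0 : x != 0 by apply: contraTneq x0 => ->; rewrite dotv0l ltxx.
have nx : 0 < norm2 x by rewrite norm2_gt0.
pose u := (norm2 x)^-1 *: x.
have uP : dotv u xs = P x / norm2 x by rewrite dotvZl mulrC.
have u0 : 0 < dotv u xs by rewrite uP divr_gt0.
have := grad_remainder f_scale f_smooth f_ball xs_sphere xs_grad v_eigen
  v_orthonormal v_first hM1 (sphere_normalize xn0 : unit_sphere u) u0.
rewrite uP => h.
have Pn := le_norm2_P xs_sphere x.
have : norm2 (drift_rem x) <= M1 * (norm2 x - P x).
  apply: le_of_sqr; rewrite ?norm2_ge0 ?mulr_ge0 ?(M1_ge0 hM1) ?subr_ge0 //.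
  rewrite norm2_sqr (parseval v_orthonormal).
  under eq_bigr => k _ do rewrite (dotv_basis v_orthonormal) -expr2 exprMn.
  rewrite -mulr_sumr; apply: le_trans (ler_wpM2l (sqr_ge0 _) h) _.
  by rewrite -exprMn mulrCA mulrBr mulr1 mulrCA mulfV ?mulr1 // gt_eqF.
move/le_trans; apply; rewrite muE -mulrA.
apply: ler_pM; rewrite ?(M1_ge0 hM1) ?subr_ge0 //.
exact: cone_gap.
Qed.

Lemma noise_le y x S : S \in batches s -> 0 < dotv x y -> 0 < P x -> 0 < P y ->
  norm2 (noise f y x S) <= Num.sqrt L * norm2 (slope x - slope y) * P x.
Proof.
move=> hS xy x0 y0; apply: le_of_sqr; rewrite ?norm2_ge0 //.
  by rewrite !mulr_ge0 ?sqrtr_ge0 ?norm2_ge0 // ltW.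
rewrite norm2_sqr; apply: le_trans (noise_L f_scale f_smooth f_ball (P x / P y) hL hS xy) _.
rewrite dist_slope ?lt0r_neq0 // dotvZl dotvZr -norm2_sqr.
by rewrite !exprMn (sqr_sqrtr L_ge0) le_eqVlt; apply/orP; left; apply/eqP; ring.
Qed.

Lemma bm_ge : eta * G <= bm.
Proof.
have [e0 e1] := andP eta_range.
have h1 := mulr_ge0 (ltW e0) lamb0; have h2 := mulr_ge0 (ltW e0) mu_ge0.
by lra.
Qed.

Lemma bm_gt0 : 0 < bm.
Proof.
by apply: lt_le_trans bm_ge; rewrite mulr_gt0 ?G0 //; case/andP: eta_range.
Qed.

(** One step from x in an epoch with reference point y, when the slopes of x and y
    are at most t and the noise is at most nu (P x) with nu small against G t.  The
    contraction G outweighs the noise, with a quarter of it to spare; this margin is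
    used to keep the iterates strictly on the side of y where the projection is
    positive. *)
Lemma one_step y x S t nu : S \in batches s -> cone x -> 0 < P y ->
  0 < dotv x y -> 0 <= t <= 1 -> norm2 (tang x) <= t * P x ->
  Num.sqrt L * norm2 (slope x - slope y) <= nu ->
  nu <= 3 / 8 * G * t -> nu <= 2 * Num.sqrt L * t ->
  let x' := vr_step f p eta s y x S in
  [/\ 5 / 8 * bm * P x <= P x',
      norm2 (tang x') <= t * P x' - eta * G / 4 * t * P x &
      norm2 (slope x' - slope x) <= 4 * eta * (lams + 2 * Num.sqrt L) / bm * t].
Proof.
move=> hS hx y0 xy /andP[t0 t1] hxt hnu nuG nuL; rewrite /= step_lin //.
have [e0 e1] := andP eta_range; have [x0 _] := hx.
set e := drift_rem x + noise f y x S.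
have m0 := mu_ge0; have l0 := lams_gt0; have lb0 := lamb0; have g0 := G0.
have nu0 : 0 <= nu by apply: le_trans hnu; rewrite mulr_ge0 ?sqrtr_ge0 ?norm2_ge0.
have he : norm2 e <= (mu * t + nu) * P x.
  apply: le_trans (norm2D _ _) _; rewrite mulrDl; apply: lerD.
    by apply: le_trans (drift_rem_le hx) _; rewrite -mulrA ler_wpM2l.
  by apply: le_trans (noise_le hS xy x0 y0) _; rewrite ler_wpM2r // ltW.
have hPe : - ((mu * t + nu) * P x) <= P e <= (mu * t + nu) * P x.
  by rewrite -ler_norml; apply: le_trans (abs_P_le xs_sphere _) he.
have hte : norm2 (tang e) <= (mu * t + nu) * P x.
  exact: le_trans (norm2_tang xs_sphere _) he.
set x' := drift_lin x + eta *: e.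
have Px' : P x' = (1 - eta + eta * lams) * P x + eta * P e.
  by rewrite /x' dotvDl P_drift_lin dotvZl.
have tx' : tang x' = tang (drift_lin x) + eta *: tang e by rewrite /x' tangD tangZ.
have mut : mu * t <= mu by rewrite -[leRHS]mulr1 ler_wpM2l.
have c1 : 5 / 8 * bm * P x <= P x'.
  have [hl _] := andP hPe; have := ler_wpM2l (ltW e0) hl => h1.
  have k1 : eta * ((mu * t + nu) * P x) <= eta * ((mu + 3 / 8 * G) * P x).
    rewrite ler_wpM2l ?(ltW e0) // ler_wpM2r ?(ltW x0) // lerD //.
    by apply: le_trans nuG _; rewrite -[leRHS]mulr1 ler_wpM2l // mulr_ge0 // ltW.
  have k2 := ler_wpM2r (ltW x0) bm_ge.
  rewrite Px'; lra.
have Px'0 : 0 < P x'.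
  by apply: lt_le_trans c1; rewrite !mulr_gt0 // ?bm_gt0 // divr_gt0.
split => //.
- apply: (@le_trans _ _ ((1 - eta + eta * lamb) * (t * P x)
      + eta * ((mu * t + nu) * P x))).
    rewrite tx'; apply: le_trans (norm2D _ _) _; apply: lerD.
      apply: le_trans (tang_drift_lin_le x) _; rewrite ler_wpM2l //.
      by rewrite addr_ge0 ?subr_ge0 // mulr_ge0 // ltW.
    by rewrite norm2Z gtr0_norm // ler_wpM2l // ltW.
  have [hl _] := andP hPe; have := ler_wpM2l t0 (ler_wpM2l (ltW e0) hl) => h1.
  (* nu (1 + t) <= 2 nu leaves a quarter of eta G t P x. *)
  have k1 : eta * P x * (nu * (1 + t)) <= eta * P x * (3 / 4 * G * t).
    rewrite ler_wpM2l ?mulr_ge0 ?(ltW e0) ?(ltW x0) //.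
    have : nu * (1 + t) <= nu * 2 by rewrite ler_wpM2l //; lra.
    by lra.
  have k2 : eta * P x * (mu * t * t) <= eta * P x * (mu * t).
    rewrite ler_wpM2l ?mulr_ge0 ?(ltW e0) ?(ltW x0) //.
    by rewrite -[leRHS]mulr1 ler_wpM2l // mulr_ge0.
  by rewrite Px'; lra.
have sE : slope x' - slope x = (P x')^-1 *: (tang x' - (P x' / P x) *: tang x).
  by rewrite /slope [RHS]scalerBr [in RHS]scalerA mulrA mulVf ?mul1r // gt_eqF.
rewrite sE norm2Z gtr0_norm ?invr_gt0 // mulrC ler_pdivrMr //.
apply: (@le_trans _ _ (eta * (2 * (lams + 2 * Num.sqrt L)) * t * P x)); last first.
  have q0 : 0 <= eta * (lams + 2 * Num.sqrt L) * t.
    by rewrite !mulr_ge0 ?addr_ge0 ?mulr_ge0 ?sqrtr_ge0 // ltW.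
  have := ler_wpM2l (divr_ge0 q0 (ltW bm_gt0)) c1.
  have -> : eta * (lams + 2 * Num.sqrt L) * t / bm * (5 / 8 * bm * P x) =
      5 / 8 * (eta * (lams + 2 * Num.sqrt L) * t * P x).
    by field; rewrite gt_eqF // bm_gt0.
  have := mulr_ge0 q0 (ltW x0); set q := eta * (lams + 2 * Num.sqrt L) * t.
  have -> : 4 * eta * (lams + 2 * Num.sqrt L) / bm * t = 4 * (q / bm).
    by rewrite /q; field; rewrite gt_eqF // bm_gt0.
  by rewrite /q; lra.
have -> : tang x' - (P x' / P x) *: tang x =
    (tang (drift_lin x) - (1 - eta + eta * lams) *: tang x) + eta *: tang e
    - (eta * P e / P x) *: tang x.
  have gen (a b u : 'cV[R]_d.+1) (c k : R) :
      a + b - (c + k) *: u = a - c *: u + b - k *: u.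
    by rewrite scalerDl opprD !addrA; congr (_ - _); rewrite addrAC.
  by rewrite tx' Px' mulrDl mulfK ?gt_eqF // gen.
apply: le_trans (norm2D _ _) _; rewrite norm2N norm2Z.
have b1 : norm2 (tang (drift_lin x) - (1 - eta + eta * lams) *: tang x + eta *: tang e)
    <= eta * (lams + lamb) * (t * P x) + eta * ((mu * t + nu) * P x).
  apply: le_trans (norm2D _ _) _; apply: lerD.
    apply: le_trans (tang_drift_lin_move x) _; rewrite ler_wpM2l //.
    by rewrite mulr_ge0 ?addr_ge0 // ltW.
  by rewrite norm2Z gtr0_norm // ler_wpM2l // ltW.
have b2 : `|eta * P e / P x| * norm2 (tang x) <= eta * ((mu * t + nu) * P x).
  rewrite normrM normfV (gtr0_norm x0) normrM (gtr0_norm e0).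
  have Pe : `|P e| <= (mu * t + nu) * P x by rewrite ler_norml.
  have tx : norm2 (tang x) / P x <= 1.
    rewrite ler_pdivrMr // mul1r; apply: le_trans hxt _.
    by rewrite -[leRHS]mul1r ler_wpM2r // ltW.
  rewrite -!mulrA ler_wpM2l ?(ltW e0) // [X in _ * X]mulrC.
  rewrite -[leRHS]mulr1; apply: ler_pM => //.
  by rewrite divr_ge0 ?norm2_ge0 // ltW.
apply: le_trans (lerD b1 b2) _.
have k1 := ler_wpM2l (mulr_ge0 (ltW e0) (ltW x0)) nuL.
have k2 : 0 <= eta * P x * t * G.
  by rewrite !mulr_ge0 // ltW.
by lra.
Qed.

(** * Second moments of one step *)

Lemma Ebatch_le (X Y : {set 'I_n} -> R) :
  (forall S, S \in batches s -> X S <= Y S) -> Ebatch s X <= Ebatch s Y.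
Proof.
by move=> h; rewrite /Ebatch ler_wpM2l ?invr_ge0 ?ler0n //; apply: ler_sum.
Qed.

Lemma eq_Ebatch (X Y : {set 'I_n} -> R) :
  (forall S, S \in batches s -> X S = Y S) -> Ebatch s X = Ebatch s Y.
Proof. by move=> h; rewrite /Ebatch; congr (_ * _); apply: eq_bigr. Qed.

(** The distance of x to the line of y is split into the two tangential parts. *)
Lemma noise_second_moment y x t : 0 < P x -> 0 < P y -> 0 < dotv x y -> 0 <= t ->
  norm2 (tang y) <= t * P y ->
  Ebatch s (fun S => norm2 (noise f y x S) ^+ 2) <=
  2 * K * (norm2 (tang x) ^+ 2 + t ^+ 2 * P x ^+ 2).
Proof.
move=> x0 y0 xy t0 hy.
rewrite (@eq_Ebatch _ (fun S => dotv (noise f y x S) (noise f y x S))); last first.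
  by move=> S _; rewrite norm2_sqr.
apply: le_trans (noise_K f_scale f_smooth f_ball (P x / P y) hK xy) _.
rewrite (mulrC 2) -mulrA ler_wpM2l ?K_ge0 // dist_tang ?lt0r_neq0 //.
set c := P x / P y; have c0 : 0 <= c by rewrite divr_ge0 ?ltW.
have h : c ^+ 2 * norm2 (tang y) ^+ 2 <= t ^+ 2 * P x ^+ 2.
  rewrite -!exprMn; apply: sqr_le_of; first by rewrite mulr_ge0 ?norm2_ge0.
  apply: le_trans (ler_wpM2l c0 hy) _.
  by rewrite mulrCA /c divfK // gt_eqF.
apply: le_trans (dotv_sub_le _ _) _; rewrite ler_wpM2l // -!norm2_sqr lerD2l.
by rewrite norm2Z (ger0_norm c0) exprMn.
Qed.

(** T stands for a coordinate projection; the noise is centred, so second moments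
    add up. *)
Lemma step_second_moment (T : 'cV[R]_d.+1 -> 'cV[R]_d.+1) y x :
  (forall a b, T (a + b) = T a + T b) -> (forall c a, T (c *: a) = c *: T a) ->
  0 < dotv x y ->
  Ebatch s (fun S => norm2 (T (vr_step f p eta s y x S)) ^+ 2) =
  norm2 (T (drift_lin x + eta *: drift_rem x)) ^+ 2
  + eta ^+ 2 * Ebatch s (fun S => norm2 (T (noise f y x S)) ^+ 2).
Proof.
move=> TD TZ xy; have [s0 sn] := andP hs.
rewrite (@eq_Ebatch _ (fun S =>
    dotv (T (drift_lin x + eta *: drift_rem x) + eta *: T (noise f y x S))
         (T (drift_lin x + eta *: drift_rem x) + eta *: T (noise f y x S)))); last first.
  move=> S hS; rewrite step_lin // norm2_sqr.
  have -> : T (drift_lin x + eta *: (drift_rem x + noise f y x S)) =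
      T (drift_lin x + eta *: drift_rem x) + eta *: T (noise f y x S).
    by rewrite -TZ -TD scalerDr addrA.
  by [].
rewrite Ebatch_sqr // ?norm2_sqr.
  by congr (_ + _ * _); apply: eq_Ebatch => S _; rewrite norm2_sqr.
have T0 : T 0 = 0 by have := TZ 0 0; rewrite !scale0r.
by rewrite -(big_morph T TD T0) (sum_noise f_scale f_smooth f_ball) // T0.
Qed.

Lemma Ebatch_tang y x t : cone x -> 0 < P y -> 0 < dotv x y -> 0 <= t ->
  norm2 (tang y) <= t * P y ->
  Ebatch s (fun S => norm2 (tang (vr_step f p eta s y x S)) ^+ 2) <=
  (al ^+ 2 + 2 * eta ^+ 2 * K) * norm2 (tang x) ^+ 2
  + 2 * eta ^+ 2 * K * (t ^+ 2 * P x ^+ 2).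
Proof.
move=> hx y0 xy t0 hy; have [e0 e1] := andP eta_range; have [x0 _] := hx.
rewrite step_second_moment //; [|exact: tangD|exact: tangZ].
have h1 : norm2 (tang (drift_lin x + eta *: drift_rem x)) <= al * norm2 (tang x).
  rewrite tangD tangZ; apply: le_trans (norm2D _ _) _.
  rewrite norm2Z gtr0_norm //; have := tang_drift_lin_le x.
  have := ler_wpM2l (ltW e0) (le_trans (norm2_tang xs_sphere _) (drift_rem_le hx)).
  by lra.
have := sqr_le_of (norm2_ge0 _) h1; rewrite exprMn => h2.
have h3 : Ebatch s (fun S => norm2 (tang (noise f y x S)) ^+ 2) <=
    Ebatch s (fun S => norm2 (noise f y x S) ^+ 2).
  by apply: Ebatch_le => S _; apply: sqr_le_of (norm2_ge0 _) (norm2_tang _ _).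
have h4 := le_trans h3 (noise_second_moment x0 y0 xy t0 hy).
by have := ler_wpM2l (sqr_ge0 eta) h4; lra.
Qed.

Lemma P_second_moment y x : 0 < dotv x y ->
  Ebatch s (fun S => P (vr_step f p eta s y x S) ^+ 2) =
  P (drift_lin x + eta *: drift_rem x) ^+ 2
  + eta ^+ 2 * Ebatch s (fun S => P (noise f y x S) ^+ 2).
Proof.
move=> xy; have nP a : norm2 (a *: xs) ^+ 2 = a ^+ 2.
  by rewrite norm2Z (xs_sphere : norm2 xs = 1) mulr1 real_normK ?num_real.
have TD (a b : 'cV[R]_d.+1) : P (a + b) *: xs = P a *: xs + P b *: xs.
  by rewrite dotvDl scalerDl.
have TZ (c : R) (a : 'cV[R]_d.+1) : P (c *: a) *: xs = c *: (P a *: xs).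
  by rewrite dotvZl scalerA.
have := step_second_moment TD TZ xy; rewrite !nP.
rewrite (eq_Ebatch (fun S _ => nP _)) => ->; congr (_ + _ * _).
by apply: eq_Ebatch => S _; rewrite nP.
Qed.

Lemma P_mean_bounds x : cone x ->
  bm * P x <= P (drift_lin x + eta *: drift_rem x) <= bp * P x.
Proof.
move=> hx; have [e0 e1] := andP eta_range; have [x0 _] := hx.
have tx := cone_tang xs_sphere D0_ge0 D0_le hx.
have h : `|P (drift_rem x)| <= mu * P x.
  apply: le_trans (abs_P_le xs_sphere _) _; apply: le_trans (drift_rem_le hx) _.
  by rewrite ler_wpM2l ?mu_ge0.
rewrite dotvDl dotvZl P_drift_lin; move: h; rewrite ler_norml => /andP[h1 h2].
have := ler_wpM2l (ltW e0) h1; have := ler_wpM2l (ltW e0) h2 => {}h1 {}h2.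
by apply/andP; split; lra.
Qed.

Lemma Ebatch_P_ge y x : cone x -> 0 < dotv x y ->
  bm ^+ 2 * P x ^+ 2 <= Ebatch s (fun S => P (vr_step f p eta s y x S) ^+ 2).
Proof.
move=> hx xy; rewrite P_second_moment //; have [x0 _] := hx.
have /andP[h _] := P_mean_bounds hx.
apply: ler_wpDr.
  rewrite mulr_ge0 ?sqr_ge0 // /Ebatch mulr_ge0 ?invr_ge0 ?ler0n //.
  by apply: sumr_ge0 => S _; exact: sqr_ge0.
by rewrite -exprMn; apply: sqr_le_of => //; rewrite mulr_ge0 ?ltW ?bm_gt0.
Qed.

Lemma Ebatch_P_le y x t : cone x -> 0 < P y -> 0 < dotv x y -> 0 <= t <= 1 ->
  norm2 (tang y) <= t * P y ->
  Ebatch s (fun S => P (vr_step f p eta s y x S) ^+ 2) <=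
  (bp ^+ 2 + 4 * eta ^+ 2 * K) * P x ^+ 2.
Proof.
move=> hx y0 xy /andP[t0 t1] hy; rewrite P_second_moment //; have [x0 _] := hx.
have /andP[h h'] := P_mean_bounds hx.
have bP0 : 0 <= P (drift_lin x + eta *: drift_rem x).
  by apply: le_trans h; rewrite mulr_ge0 ?ltW ?bm_gt0.
have := sqr_le_of bP0 h'; rewrite exprMn => h2.
have h3 : Ebatch s (fun S => P (noise f y x S) ^+ 2) <=
    Ebatch s (fun S => norm2 (noise f y x S) ^+ 2).
  apply: Ebatch_le => S _; rewrite -(real_normK (num_real (P _))).
  exact: sqr_le_of (normr_ge0 _) (abs_P_le _ _).
have h4 := le_trans h3 (noise_second_moment x0 y0 xy t0 hy).
have tx := sqr_le_of (norm2_ge0 _) (cone_tang xs_sphere D0_ge0 D0_le hx).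
have t2 : t ^+ 2 <= 1 by rewrite -(expr1n _ 2); exact: sqr_le_of.
have h5 : norm2 (tang x) ^+ 2 + t ^+ 2 * P x ^+ 2 <= 2 * P x ^+ 2.
  by have := ler_wpM2r (sqr_ge0 (P x)) t2; lra.
have K0 := K_ge0.
have := ler_wpM2l (mulr_ge0 (sqr_ge0 eta) K0) h5.
by have := ler_wpM2l (sqr_ge0 eta) h4; lra.
Qed.

(** * The invariant within one epoch *)

Variable m : nat.
Hypothesis m_gt0 : (0 < m)%N.
Notation kap := (4 * eta * (lams + 2 * Num.sqrt L) / bm).
(** The fraction multiplied by m bounds, relative to the initial slope, the
    displacement of the slope in one step. *)
Hypothesis small_noise :
  Num.sqrt L * 2 <= 3 / 8 * G \/ Num.sqrt L * (m%:R * kap) <= 3 / 8 * G.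
Notation inner y u := (inner_iter f p eta s y u).
Notation batchseq u := (all (mem (batches s)) u).

Lemma kap_ge0 : 0 <= kap.
Proof.
have [e0 e1] := andP eta_range; rewrite divr_ge0 ?(ltW bm_gt0) //.
by rewrite !mulr_ge0 ?addr_ge0 ?mulr_ge0 ?sqrtr_ge0 ?(ltW lams_gt0) // ltW.
Qed.

Lemma D0_le1 : D0 <= 1.
Proof.
have := D0_le; have : 0 <= (Num.sqrt 2)^-1 :> R by rewrite invr_ge0 sqrtr_ge0.
by lra.
Qed.

(** The slope of the iterates stays below that of the reference point y.  The noise
    is at most sqrt L times the displacement of the slope, which is at most 2 t and
    at most (size u) times the length of one step; either estimate makes the noise
    small enough for [one_step]. *)
Lemma inner_invariant y t u : cone y -> norm2 (tang y) = t * P y -> 0 <= t <= 1 ->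
  batchseq u -> (size u <= m)%N ->
  [/\ 0 < P (inner y u), norm2 (tang (inner y u)) <= t * P (inner y u),
      0 < dotv (inner y u) y &
      norm2 (slope (inner y u) - slope y) <= (size u)%:R * (kap * t)].
Proof.
move=> hy yt t01; have [y0 _] := hy; have [t0 t1] := andP t01.
have yy0 : 0 < dotv y y.
  rewrite lt_def dotv_ge0 dotv_eq0 andbT.
  by apply: contraTneq y0 => ->; rewrite dotv0l ltxx.
elim/last_ind: u => [|u S IH].
  rewrite /inner_iter /= => _ _; split; rewrite ?yt //.
  by rewrite subrr norm2E dotv0l sqrtr0 mul0r.
rewrite all_rcons size_rcons => /andP[hS hu] um.
have [x0 xt xy xD] := IH hu (ltnW um).
have -> : inner y (rcons u S) = vr_step f p eta s y (inner y u) S.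
  by rewrite /inner_iter foldl_rcons.
set x := inner y u in x0 xt xy xD *; clearbody x.
have hx : cone x.
  apply: cone_closer hy x0 _; rewrite ?D0_ge0 ?D0_le1 // yt.
  by rewrite -mulrA (mulrC (P y)) mulrA ler_wpM2r // ltW.
have D2 : norm2 (slope x - slope y) <= 2 * t.
  apply: le_trans (norm2D _ _) _; rewrite norm2N.
  have h1 : norm2 (slope x) <= t by rewrite slope_le.
  have h2 : norm2 (slope y) <= t by rewrite slope_le // yt.
  by lra.
have sL := sqrtr_ge0 L.
have nuL : Num.sqrt L * norm2 (slope x - slope y) <= 2 * Num.sqrt L * t.
  by rewrite (mulrC 2) -mulrA ler_wpM2l.
have nuG : Num.sqrt L * norm2 (slope x - slope y) <= 3 / 8 * G * t.
  case: small_noise => h.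
    by apply: le_trans nuL _; have := ler_wpM2r t0 h; lra.
  apply: le_trans (ler_wpM2l sL xD) _.
  have um' : (size u)%:R * (kap * t) <= m%:R * (kap * t).
    by apply: ler_wpM2r (mulr_ge0 kap_ge0 t0) _ _ _; rewrite ler_nat ltnW.
  apply: le_trans (ler_wpM2l sL um') _.
  by have := ler_wpM2r t0 h; rewrite !mulrA.
have [c1 c2 c3] := one_step hS hx y0 xy t01 xt (lexx _) nuG nuL.
set x' := vr_step _ _ _ _ _ _ _ in c1 c2 c3 *; clearbody x'.
have Px'0 : 0 < P x'.
  by apply: lt_le_trans c1; rewrite !mulr_gt0 // ?bm_gt0 // divr_gt0.
have [e0 e1] := andP eta_range.
have g0 : 0 < eta * G / 4 * P x by rewrite !mulr_gt0 // ?G0 // divr_gt0.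
split => //.
- apply: le_trans c2 _; rewrite gerBl.
  by rewrite mulrAC mulr_ge0 // ltW.
- rewrite (dotv_split xs_sphere).
  have := cauchy_schwarz (tang x') (tang y); rewrite ler_norml => /andP[h _].
  have h2 : norm2 (tang x') * norm2 (tang y) <=
      (t * P x' - eta * G / 4 * t * P x) * (t * P y).
    by rewrite yt ler_wpM2r // mulr_ge0 // ltW.
  apply: positive_after_rotation t0 t1 Px'0 y0 g0 _.
  apply: le_trans h; rewrite lerN2; apply: le_trans h2 _.
  by rewrite (mulrAC _ t).
- have -> : slope x' - slope y = (slope x' - slope x) + (slope x - slope y).
    by rewrite addrA subrK.
  apply: le_trans (norm2D _ _) _; apply: le_trans (lerD c3 xD) _.
  by rewrite -[(size u).+1%:R]natr1 [leRHS]mulrDl mul1r [leRHS]addrC.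
Qed.

Lemma cone_ratio y : cone y -> exists2 t, 0 <= t <= 1 & norm2 (tang y) = t * P y.
Proof.
move=> hy; have [y0 _] := hy; exists (norm2 (tang y) / P y).
  rewrite divr_ge0 ?norm2_ge0 ?(ltW y0) //= ler_pdivrMr // mul1r.
  exact: cone_tang hy.
by rewrite divfK // gt_eqF.
Qed.

Lemma inner_cone y u : cone y -> batchseq u -> (size u <= m)%N -> cone (inner y u).
Proof.
move=> hy hu um; have [t t01 yt] := cone_ratio hy; have [y0 _] := hy.
have [x0 xt _ _] := inner_invariant hy yt t01 hu um.
apply: cone_closer hy x0 _; rewrite ?D0_ge0 ?D0_le1 // yt.
by rewrite -mulrA (mulrC (P y)) mulrA ler_wpM2r // ltW.
Qed.

(** * Contraction over one epoch *)

Hypothesis nu4_bound : 64 * (eta ^+ 2 * K) <= eta * G * bp.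
Hypothesis nu5_bound : 2 * m%:R * (eta * G) <= bm.
Hypothesis nu5_bound_ln : 4 * m%:R * (eta * mu) <= ln 2 * bm.
Notation rho := (eta * m%:R * G / (2 * bm)).

Lemma inner_rcons y u S : inner y (rcons u S) = vr_step f p eta s y (inner y u) S.
Proof. by rewrite /inner_iter foldl_rcons. Qed.

Lemma epoch_tang y : cone y ->
  seqmean (batches s) m (fun u => norm2 (tang (inner y u)) ^+ 2)
  <= (1 - rho) * bm ^+ 2 ^+ m * norm2 (tang y) ^+ 2.
Proof.
move=> hy; have [t t01 yt] := cone_ratio hy; have [y0 _] := hy.
have [t0 t1] := andP t01; have [e0 e1] := andP eta_range.
have b0 := bm_gt0; have k0 := mulr_ge0 (sqr_ge0 eta) K_ge0.
pose q k : R := seqmean (batches s) k (fun u => norm2 (tang (inner y u)) ^+ 2).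
pose r k : R := seqmean (batches s) k (fun u => P (inner y u) ^+ 2).
have q0 : q 0%N = norm2 (tang y) ^+ 2 by [].
have r0 : r 0%N = P y ^+ 2 by [].
have qS k : (k < m)%N -> q k.+1 <=
    (al ^+ 2 + 2 * (eta ^+ 2 * K)) * q k + 2 * (eta ^+ 2 * K) * (t ^+ 2 * r k).
  move=> km; rewrite /q seqmean_rcons [X in _ <= _ + X]mulrA -seqmeanZD.
  apply: seqmean_le => u uk hu; have um : (size u <= m)%N by rewrite uk ltnW.
  have [x0 xt xy _] := inner_invariant hy yt t01 hu um.
  have := Ebatch_tang (inner_cone hy hu um) y0 xy t0; rewrite yt => /(_ (lexx _)).
  rewrite /mean; under eq_bigr => S _ do rewrite inner_rcons.
  by rewrite /Ebatch; move/le_trans; apply; rewrite !mulrA.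
have rS k : (k < m)%N -> r k.+1 <= (bp ^+ 2 + 4 * (eta ^+ 2 * K)) * r k.
  move=> km; rewrite /r seqmean_rcons -seqmeanZ.
  apply: seqmean_le => u uk hu; have um : (size u <= m)%N by rewrite uk ltnW.
  have [x0 xt xy _] := inner_invariant hy yt t01 hu um.
  have := Ebatch_P_le (inner_cone hy hu um) y0 xy t01; rewrite yt => /(_ (lexx _)).
  rewrite /mean; under eq_bigr => S _ do rewrite inner_rcons.
  by rewrite /Ebatch; move/le_trans; apply; rewrite !mulrA.
have rhoE : m%:R * (eta * G / bm) / 2 = rho by field; rewrite gt_eqF.
have := @epoch_recursion R bm bp al (eta ^+ 2 * K) (eta * G / bm) t m q r m_gt0 b0.
rewrite -q0 -rhoE; apply => //.
- by have := mulr_ge0 (ltW e0) mu_ge0; lra.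
- by rewrite mulrBr mulr1 mulrCA mulfV ?gt_eqF // mulr1; ring.
- by rewrite divr_ge0 ?mulr_ge0 ?(ltW G0) // ltW.
- by rewrite mulrA ler_pdivrMr // mul1r; exact: nu5_bound.
- by rewrite divfK ?gt_eqF //; exact: nu4_bound.
- apply: le_trans nu5_bound_ln.
  by rewrite le_eqVlt; apply/orP; left; apply/eqP; ring.
- by rewrite r0 sqr_ge0.
- by rewrite q0 r0 yt exprMn.
Qed.

Lemma epoch_P y k : cone y -> (k <= m)%N ->
  bm ^+ 2 ^+ k * P y ^+ 2 <= seqmean (batches s) k (fun u => P (inner y u) ^+ 2).
Proof.
move=> hy; have [t t01 yt] := cone_ratio hy; have [y0 _] := hy.
elim: k => [|k IH] km; first by rewrite expr0 mul1r.
rewrite seqmean_rcons (exprS (bm ^+ 2)) -mulrA.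
apply: le_trans (ler_wpM2l (sqr_ge0 bm) (IH (ltnW km))) _; rewrite -seqmeanZ.
apply: seqmean_le => u uk hu; have um : (size u <= m)%N by rewrite uk ltnW.
have [x0 xt xy _] := inner_invariant hy yt t01 hu um.
apply: le_trans (Ebatch_P_ge (inner_cone hy hu um) xy) _.
rewrite /mean; under [X in _ <= _ * X]eq_bigr => S _ do rewrite inner_rcons.
exact: lexx.
Qed.

(** * Iteration over the epochs *)

Notation epochs := [set u : m.-tuple {set 'I_n} | batchseq u]%SET.
Notation outer x w := (foldl (fun y (u : m.-tuple {set 'I_n}) => inner y u) x w).

Lemma outer_tang T x : cone x ->
  seqmean epochs T (fun w => norm2 (tang (outer x w)) ^+ 2)
  <= ((1 - rho) * bm ^+ 2 ^+ m) ^+ T * norm2 (tang x) ^+ 2.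
Proof.
have [e0 e1] := andP eta_range; have b0 := bm_gt0.
have c0 : 0 <= (1 - rho) * bm ^+ 2 ^+ m.
  apply: mulr_ge0 (exprn_ge0 _ (sqr_ge0 _)).
  rewrite subr_ge0 ler_pdivrMr ?mulr_gt0 // mul1r.
  by have := nu5_bound; rewrite mulrAC (mulrC (eta * _)); lra.
elim: T x => [|T IH] x hx; first by rewrite expr0 mul1r.
apply: (@le_trans _ _ (((1 - rho) * bm ^+ 2 ^+ m) ^+ T *
    mean epochs (fun u => norm2 (tang (inner x u)) ^+ 2))).
  rewrite -[X in _ <= X]addr0 -(mul0r (mean epochs (fun=> 0))) -meanZD.
  apply: mean_le => u; rewrite inE => hu; rewrite mul0r addr0.
  by apply: IH; apply: inner_cone; rewrite ?size_tuple.
rewrite (exprSr ((1 - rho) * bm ^+ 2 ^+ m)) -[leRHS]mulrA; apply: ler_wpM2l; first exact: exprn_ge0.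
apply: le_trans (epoch_tang hx); rewrite seqmeanE.
exact: lexx.
Qed.

Lemma outer_P T x : cone x ->
  (bm ^+ 2 ^+ m) ^+ T * P x ^+ 2 <=
  seqmean epochs T (fun w => P (outer x w) ^+ 2).
Proof.
have c0 : 0 <= bm ^+ 2 ^+ m by rewrite exprn_ge0 ?sqr_ge0.
elim: T x => [|T IH] x hx; first by rewrite expr0 mul1r.
apply: (@le_trans _ _ ((bm ^+ 2 ^+ m) ^+ T *
    mean epochs (fun u => P (inner x u) ^+ 2))).
  rewrite (exprSr (bm ^+ 2 ^+ m)) -[leLHS]mulrA; apply: ler_wpM2l; first exact: exprn_ge0.
  apply: le_trans (epoch_P hx (leqnn m)) _; rewrite seqmeanE.
  exact: lexx.
rewrite -[X in X <= _]addr0 -(mul0r (mean epochs (fun=> 0))) -meanZD.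
apply: mean_le => u; rewrite inE => hu; rewrite mul0r addr0.
by apply: IH; apply: inner_cone; rewrite ?size_tuple.
Qed.

Lemma Etotal_seqmean T (X : seq (m.-tuple {set 'I_n}) -> R) :
  Etotal s (fun w : T.-tuple (m.-tuple {set 'I_n}) => X w) = seqmean epochs T X.
Proof.
rewrite seqmeanE /Etotal.
have -> // : @outcomes n s m T = [set w : T.-tuple (m.-tuple {set 'I_n}) |
    all (mem epochs) w]%SET.
by apply/setP => w; rewrite !inE; apply: eq_all => u; rewrite !inE.
Qed.

Lemma gap_contraction x T : cone x ->
  0 < gap_den f p eta s m v x T /\
  gap f p eta s m v x T <= (1 - rho) ^+ T * gap f p eta s m v x 0.
Proof.
move=> hx; have [x0 _] := hx; have b0 := bm_gt0.
have numE k : gap_num f p eta s m v x k =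
    seqmean epochs k (fun w => norm2 (tang (outer x w)) ^+ 2).
  rewrite -Etotal_seqmean /gap_num /Etotal; congr (_ * _).
  by apply: eq_bigr => w _; rewrite norm2_tang_sqr.
have denE k : gap_den f p eta s m v x k =
    seqmean epochs k (fun w => P (outer x w) ^+ 2).
  by rewrite -Etotal_seqmean /gap_den v_first.
have d0 : gap_den f p eta s m v x 0 = P x ^+ 2 by rewrite denE.
have n0 : gap_num f p eta s m v x 0 = norm2 (tang x) ^+ 2 by rewrite numE.
have cT : 0 < (bm ^+ 2 ^+ m) ^+ T * P x ^+ 2.
  by apply: mulr_gt0; rewrite ?exprn_gt0.
have hd : (bm ^+ 2 ^+ m) ^+ T * P x ^+ 2 <= gap_den f p eta s m v x T.
  by rewrite denE; exact: outer_P.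
have hn : gap_num f p eta s m v x T <=
    ((1 - rho) * bm ^+ 2 ^+ m) ^+ T * norm2 (tang x) ^+ 2.
  by rewrite numE; exact: outer_tang.
have den0 : 0 < gap_den f p eta s m v x T by exact: lt_le_trans cT hd.
split => //; rewrite /gap ler_pdivrMr // d0 n0; apply: le_trans hn _.
have r0 : 0 <= 1 - rho.
  rewrite subr_ge0 ler_pdivrMr ?mulr_gt0 // mul1r.
  by have := nu5_bound; rewrite mulrAC (mulrC (eta * _)); lra.
have t0 : 0 <= (1 - rho) ^+ T * (norm2 (tang x) ^+ 2 / P x ^+ 2).
  by rewrite mulr_ge0 ?exprn_ge0 ?divr_ge0 ?sqr_ge0.
apply: le_trans (ler_wpM2l t0 hd).
rewrite exprMn le_eqVlt; apply/orP; left; apply/eqP.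
by field; rewrite gt_eqF.
Qed.

(** 1 - rho <= exp (- rho). *)
Lemma gap_at_ceil x eps : cone x -> 0 < eps ->
  let tau := nat_ceil (rho^-1 * ln (gap f p eta s m v x 0 / eps)) in
  0 < gap_den f p eta s m v x tau /\ gap f p eta s m v x tau <= eps.
Proof.
move=> hx eps0 /=; set delta0 := gap f p eta s m v x 0.
set T := nat_ceil _; have [dpos hT] := gap_contraction T hx; split => //.
apply: le_trans hT _; rewrite -/delta0; clearbody delta0.
have [e0 e1] := andP eta_range.
have rho0 : 0 < rho.
  by rewrite divr_gt0 ?mulr_gt0 ?bm_gt0 ?G0 ?ltr0n.
have rho1 : rho <= 1.
  rewrite ler_pdivrMr ?mulr_gt0 ?bm_gt0 // mul1r.
  by have := nu5_bound; have := bm_gt0; rewrite mulrAC (mulrC (eta * _)); lra.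
have [d0|d0] := leP delta0 0.
  apply: le_trans (ltW eps0); rewrite mulr_ge0_le0 //.
  by rewrite exprn_ge0 // subr_ge0.
have cT : rho^-1 * ln (delta0 / eps) <= T%:R.
  apply: le_trans (ceil_ge _) _; rewrite -[T%:R]/(T%:Z%:~R) ler_int.
  rewrite /T /nat_ceil abszE ger0_norm ?le_max ?lexx //.
  by rewrite orbT.
have hexp : (1 - rho) ^+ T <= eps / delta0.
  apply: (@le_trans _ _ (expR (T%:R * - rho))).
    by apply: onem_exp_le; rewrite subr_ge0.
  rewrite -[leRHS]lnK ?posrE ?divr_gt0 // ler_expR.
  have -> : eps / delta0 = (delta0 / eps)^-1 by rewrite invf_div.
  rewrite lnV ?posrE ?divr_gt0 // mulrN lerN2 -ler_pdivrMr // mulrC.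
  exact: cT.
by have := ler_wpM2r (ltW d0) hexp; rewrite divfK // gt_eqF.
Qed.

End Dynamics.

(** * From the conditions on the constants to the theorem *)

Lemma eta_le_max {R : realType} (eta z y : R) : 0 < eta ->
  eta <= (Num.max 1 z)^-1 -> y <= z -> eta * y <= 1.
Proof.
move=> e0 h yz; have m0 : 0 < Num.max 1 z by rewrite lt_max ltr01.
have : eta * Num.max 1 z <= 1.
  by have := ler_wpM2r (ltW m0) h; rewrite mulVf // gt_eqF.
by apply: le_trans; rewrite ler_wpM2l ?(ltW e0) // le_max yz orbT.
Qed.

Lemma small_noise_of_L {R : realType} (L G : R) : 0 <= L -> 0 <= G ->
  L <= G ^+ 2 / 32 -> Num.sqrt L * 2 <= 3 / 8 * G.
Proof.
move=> L0 G0 h; apply: le_of_sqr; rewrite ?mulr_ge0 ?sqrtr_ge0 ?divr_ge0 //.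
rewrite !exprMn sqr_sqrtr //; have := sqr_ge0 G; lra.
Qed.

(** The step-size condition bounds eta L m (lams + 2 sqrt L) by bm G^2 / 128.  As L is
    large here, one factor G is at most 6 sqrt L, and dividing by sqrt L leaves a
    bound linear in G. *)
Lemma small_noise_of_eta {R : realType} (L G eta theta1 theta2 lams lamb D bm al : R)
    (m : nat) :
  0 <= L -> 0 < G -> 0 < eta -> 0 < lams -> 0 <= lamb -> lamb <= lams ->
  0 <= D -> D <= 1 -> 0 <= theta2 -> theta2 <= G -> (0 < m)%N ->
  lams + 2 * Num.sqrt L <= theta1 -> 0 < bm -> al <= bm ->
  theta2 ^+ 2 * lamb * D * Num.sqrt D != 0 ->
  eta * (128 * L * theta1 * lams * m%:R ^+ 2 /
     (theta2 ^+ 2 * lamb * D * Num.sqrt D)) <= al ->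
  G ^+ 2 / 32 < L ->
  Num.sqrt L * (m%:R * (4 * eta * (lams + 2 * Num.sqrt L) / bm)) <= 3 / 8 * G.
Proof.
move=> L0 G0 e0 l0 lb0 lbl D0 D1 t0 tG m0 th bm0 albm dn0 hal hL.
have d0 : 0 < theta2 ^+ 2 * lamb * D * Num.sqrt D.
  by rewrite lt_def dn0 !mulr_ge0 ?sqr_ge0 ?sqrtr_ge0.
have sD1 : D * Num.sqrt D <= 1.
  rewrite -[leRHS]mul1r; apply: ler_pM; rewrite ?sqrtr_ge0 //.
  by rewrite -sqrtr1 ler_sqrt.
have dG : theta2 ^+ 2 * lamb * D * Num.sqrt D <= G ^+ 2 * lams.
  rewrite -mulrA -[leRHS]mulr1.
  apply: ler_pM sD1; rewrite ?mulr_ge0 ?sqr_ge0 ?sqrtr_ge0 //.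
  by apply: ler_pM; rewrite ?sqr_ge0 //; exact: sqr_le_of.
have al0 : 0 <= al.
  apply: le_trans hal; rewrite mulr_ge0 ?(ltW e0) // divr_ge0 ?(ltW d0) //.
  have th0 : 0 <= theta1 by apply: le_trans th; rewrite addr_ge0 ?(ltW l0) // mulr_ge0 ?sqrtr_ge0.
  by rewrite !mulr_ge0 ?exprn_ge0 // ltW.
set S := Num.sqrt L; have S0 : 0 < S.
  rewrite sqrtr_gt0; apply: le_lt_trans hL.
  by rewrite divr_ge0 ?sqr_ge0.
have LS : L = S ^+ 2 by rewrite sqr_sqrtr.
have h1 : eta * (128 * L * theta1 * m%:R ^+ 2) <= bm * G ^+ 2.
  rewrite -(ler_pM2r l0).
  apply: (@le_trans _ _ (al * (theta2 ^+ 2 * lamb * D * Num.sqrt D))).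
    have := ler_wpM2r (ltW d0) hal; rewrite mulrA divfK //.
    by apply: le_trans; rewrite le_eqVlt; apply/orP; left; apply/eqP; ring.
  apply: le_trans (ler_wpM2l al0 dG) _; rewrite mulrA ler_wpM2r ?(ltW l0) //.
  by rewrite ler_wpM2r ?sqr_ge0.
have mR : 1 <= m%:R :> R by rewrite ler1n.
have h2 : eta * (128 * L * (lams + 2 * S) * m%:R) <= bm * G ^+ 2.
  apply: le_trans h1; rewrite ler_wpM2l ?(ltW e0) //.
  apply: ler_pM => //.
  - by rewrite !mulr_ge0 ?addr_ge0 ?(ltW l0) ?mulr_ge0 ?(ltW S0).
  - by rewrite ler_wpM2l ?mulr_ge0.
  - by rewrite expr2 ler_peMl // (le_trans ler01).
have GS : G <= 6 * S.
  apply: le_of_sqr; rewrite ?(ltW G0) ?mulr_ge0 ?(ltW S0) //.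
  by rewrite exprMn -LS; move: hL; lra.
rewrite -(ler_pM2r S0) -(ler_pM2r bm0).
have -> : S * (m%:R * (4 * eta * (lams + 2 * S) / bm)) * S * bm =
    eta * (128 * L * (lams + 2 * S) * m%:R) / 32.
  by rewrite LS; field; rewrite gt_eqF.
have := ler_wpM2l (mulr_ge0 (ltW bm0) (ltW G0)) GS; rewrite expr2 in h2.
by have := mulr_ge0 (mulr_ge0 (ltW bm0) (ltW G0)) (ltW S0); lra.
Qed.

(** The form in which the hypotheses on D, L and eta enter the dynamics.  The bound on
    D gives 4 sqrt D sqrt L0 <= G, thus 0 <= theta2 <= G. *)
Lemma parameter_bounds {R : realType}
    (eta lams lamb sigma M L L0 K D mu theta1 theta2 den3 den4 : R)
    (nu1 nu2 nu3 nu4 nu5 : R) (m : nat) :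
  0 < eta -> eta <= 1 -> 0 <= lamb -> lamb < lams -> 0 <= sigma -> 0 <= M ->
  0 <= L -> L <= L0 -> 0 <= D -> D <= 1 -> (0 < m)%N -> mu = M * Num.sqrt D ->
  theta1 = lams + sigma + M * Num.sqrt (D / 2) + 2 * Num.sqrt L ->
  theta2 = lams - lamb - 2 * Num.sqrt D * (M + 2 * Num.sqrt L) ->
  den3 = theta2 ^+ 2 * lamb * D * Num.sqrt D ->
  den4 = lams - lamb - 2 * M * Num.sqrt D ->
  nu3 = 128 * L * theta1 * lams * m%:R ^+ 2 / den3
    + 1 - (lamb + M * Num.sqrt D) ->
  nu4 = 1 - lams - M * Num.sqrt D
    + Num.max (Num.sqrt (K * m%:R)) (64 * K / den4) ->
  nu5 = 1 - lams + M * Num.sqrt D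
    + Num.max (2 * m%:R * (lams - lamb - 2 * M * Num.sqrt D))
              (4 * m%:R * M * Num.sqrt D / ln 2) ->
  (M + 2 * Num.sqrt L0 != 0 ->
     D <= (lams - lamb) ^+ 2 / (4 * (M + 2 * Num.sqrt L0) ^+ 2)) ->
  L <= (lams - lamb - 2 * M * Num.sqrt D) ^+ 2 / 32 \/
  den3 != 0 /\ eta <= (Num.max 1 (Num.max nu1 (Num.max nu2 nu3)))^-1 ->
  den4 != 0 /\ eta <= (Num.max 1 (Num.max nu4 nu5))^-1 ->
  let G := lams - lamb - 2 * mu in
  let bm := 1 - eta + eta * (lams - mu) in
  [/\ 0 < G,
      Num.sqrt L * 2 <= 3 / 8 * G \/
      Num.sqrt L * (m%:R * (4 * eta * (lams + 2 * Num.sqrt L) / bm)) <= 3 / 8 * G,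
      64 * (eta ^+ 2 * K) <= eta * G * (1 - eta + eta * (lams + mu)),
      2 * m%:R * (eta * G) <= bm &
      4 * m%:R * (eta * mu) <= ln 2 * bm].
Proof.
move=> e0 e1 lamb0 lam_gap sig0 M0 Lge0 LL0 D00 D1 hm muE th1E th2E den3E den4E.
move=> nu3E nu4E nu5E A2 hBC [den4_neq0 hD] G bm; rewrite {}/G {}/bm.
have lams0 := le_lt_trans lamb0 lam_gap; have lbl := ltW lam_gap.
have GE : lams - lamb - 2 * M * Num.sqrt D = lams - lamb - 2 * mu.
  by rewrite muE mulrA.
have sD := sqrtr_ge0 D; have sL := sqrtr_ge0 L; have sL0 := sqrtr_ge0 L0.
have sLL0 : Num.sqrt L <= Num.sqrt L0 by rewrite ler_sqrt // (le_trans Lge0).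
have Gsplit : 2 * Num.sqrt D * (M + 2 * Num.sqrt L0) <= lams - lamb.
  have [z|nz] := eqVneq (M + 2 * Num.sqrt L0) 0.
    by rewrite z mulr0 subr_ge0.
  have w0 : 0 < M + 2 * Num.sqrt L0 by rewrite lt_def nz addr_ge0 // mulr_ge0.
  have := A2 nz; rewrite ler_pdivlMr ?mulr_gt0 ?exprn_gt0 // => h.
  apply: le_of_sqr; rewrite ?mulr_ge0 ?subr_ge0 ?(ltW w0) //.
  by rewrite !exprMn sqr_sqrtr //; move: h; lra.
have Gsplit' : 4 * (Num.sqrt D * Num.sqrt L0) <= lams - lamb - 2 * mu.
  by rewrite muE; move: Gsplit; lra.
have sDL0 : 0 <= Num.sqrt D * Num.sqrt L0 by rewrite mulr_ge0.
have sDL : Num.sqrt D * Num.sqrt L <= Num.sqrt D * Num.sqrt L0.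
  by rewrite ler_wpM2l.
have sDL' : 0 <= Num.sqrt D * Num.sqrt L by rewrite mulr_ge0.
have G0 : 0 < lams - lamb - 2 * mu.
  rewrite lt_def -GE -den4E den4_neq0 den4E GE.
  by apply: le_trans Gsplit'; rewrite mulr_ge0.
have mu0 : 0 <= mu by rewrite muE mulr_ge0.
have nu3_bound : eta <= (Num.max 1 (Num.max nu1 (Num.max nu2 nu3)))^-1 ->
    eta * (128 * L * theta1 * lams * m%:R ^+ 2 / den3) <= 1 - eta + eta * (lamb + mu).
  move=> h; have : eta * nu3 <= 1.
    by apply: eta_le_max e0 h _; rewrite !le_max lexx !orbT.
  by rewrite nu3E -muE; lra.
have nu4_bound : 64 * (eta ^+ 2 * K) <=
    eta * (lams - lamb - 2 * mu) * (1 - eta + eta * (lams + mu)).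
  have h : eta * (1 - lams - mu + 64 * K / (lams - lamb - 2 * mu)) <= 1.
    apply: (eta_le_max e0 hD); rewrite le_max; apply/orP; left.
    by rewrite nu4E -muE lerD2l le_max den4E GE lexx orbT.
  have h' : eta * (64 * K / (lams - lamb - 2 * mu)) <= 1 - eta + eta * (lams + mu).
    by move: h; lra.
  have := ler_wpM2l (mulr_ge0 (ltW e0) (ltW G0)) h'; apply: le_trans.
  rewrite le_eqVlt; apply/orP; left; apply/eqP; field; exact: lt0r_neq0.
have nu5_max c : c <= Num.max (2 * m%:R * (lams - lamb - 2 * M * Num.sqrt D))
    (4 * m%:R * M * Num.sqrt D / ln 2) -> eta * c <= 1 - eta + eta * (lams - mu).
  move=> hc; have : eta * (1 - lams + mu + c) <= 1.
    apply: (eta_le_max e0 hD); rewrite le_max; apply/orP; right.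
    by rewrite nu5E -muE lerD2l.
  by lra.
have nu5_bound : 2 * m%:R * (eta * (lams - lamb - 2 * mu)) <= 1 - eta + eta * (lams - mu).
  rewrite mulrCA; apply: nu5_max; rewrite le_max GE lexx //.
have l2 : 0 < ln 2 :> R by rewrite ln_gt0 // ltr1n.
have nu5_bound_ln : 4 * m%:R * (eta * mu) <= ln 2 * (1 - eta + eta * (lams - mu)).
  have : eta * (4 * m%:R * M * Num.sqrt D / ln 2) <= 1 - eta + eta * (lams - mu).
    by apply: nu5_max; rewrite le_max lexx orbT.
  move/(ler_wpM2l (ltW l2)); apply: le_trans.
  rewrite muE le_eqVlt; apply/orP; left; apply/eqP; field; exact: lt0r_neq0.
have bmG : eta * (lams - lamb - 2 * mu) <= 1 - eta + eta * (lams - mu).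
  by have := mulr_ge0 (ltW e0) lamb0; have := mulr_ge0 (ltW e0) mu0; lra.
have eG : 0 < eta * (lams - lamb - 2 * mu) by rewrite mulr_gt0.
split => //.
have [hL32|hL32] := leP L ((lams - lamb - 2 * mu) ^+ 2 / 32).
  by left; exact: small_noise_of_L (ltW G0) hL32.
case: hBC => [|[d3 /nu3_bound h3]]; first by rewrite GE leNgt hL32.
right; rewrite den3E in d3 h3.
apply: small_noise_of_eta d3 h3 hL32 => //.
- by rewrite th2E; move: Gsplit' sDL; rewrite muE; lra.
- by rewrite th2E muE; lra.
- by rewrite th1E; have := mulr_ge0 M0 (sqrtr_ge0 (D / 2)); lra.
- exact: lt_le_trans eG bmG.
- by have := mulr_ge0 (ltW e0) (ltW G0); lra.
Qed.

Theorem theorem3p6 (R : realType) (d n : nat) (hd : (2 <= d.+1)%N)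
  (* problem *)
  (f : 'I_n -> 'cV[R]_d.+1 -> R) (p : R)
  (f_scale : scale_invariant f p)
  (f_smooth : forall l, grad_C2_near_sphere (f l))
  (f_ball : derivatives_on_ball f)
  (* local solution *)
  (xs : 'cV[R]_d.+1) (lams : R)
  (xs_sphere : unit_sphere xs)
  (xs_opt : \forall x \near xs, unit_sphere x -> favg f x <= favg f xs)
  (xs_grad : grad (favg f) xs = lams *: xs)
  (lam : 'I_d.+1 -> R) (v : 'I_d.+1 -> 'cV[R]_d.+1)
  (v_eigen : forall i, hess (favg f) xs *m v i = lam i *: v i)
  (v_orthonormal : forall i j, dotv (v i) (v j) = (i == j)%:R)
  (v_first : v ord0 = xs)
  (lam_gap : \big[Num.max/0]_(i | i != ord0) `|lam i| < lams)
  (* parameters of the algorithm *)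
  (s m : nat) (hs : (1 <= s <= n)%N) (hm : (0 < m)%N)
  (eta : R) (eta_range : 0 < eta <= 1)
  (x0 : 'cV[R]_d.+1) (x0_sphere : unit_sphere x0)
  (iter_wd : iterates_well_defined f p eta s m x0)
  (* constants *)
  (M1 M2 K L L0 : R)
  (hM1 : is_max (M1_values f lams lam v) M1)
  (hM2 : is_max (M2_values f) M2)
  (hK : is_max (K_values f s) K)
  (hL : is_max (L_values f s) L)
  (hL0 : is_max (L_values f 1) L0) :
  let lamb := \big[Num.max/0]_(i | i != ord0) `|lam i| in
  let sigma := spectral_norm (hess (favg f) xs) in
  let M := Num.max M1 M2 in
  let D0 := 1 - dotv x0 xs in
  let theta1 := lams + sigma + M * Num.sqrt (D0 / 2) + 2 * Num.sqrt L in
  let theta2 := lams - lamb - 2 * Num.sqrt D0 * (M + 2 * Num.sqrt L) in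
  let nu1 := 1 - lams + 2 * theta1 * m%:R * Num.sqrt (2 * D0) in
  let nu2 := m%:R * lams + 1 - (m.+1)%:R * (lamb + M * Num.sqrt D0) in
  let den3 := theta2 ^+ 2 * lamb * D0 * Num.sqrt D0 in
  let nu3 := 128 * L * theta1 * lams * m%:R ^+ 2 / den3
             + 1 - (lamb + M * Num.sqrt D0) in
  let den4 := lams - lamb - 2 * M * Num.sqrt D0 in
  let nu4 := 1 - lams - M * Num.sqrt D0
             + Num.max (Num.sqrt (K * m%:R)) (64 * K / den4) in
  let nu5 := 1 - lams + M * Num.sqrt D0
             + Num.max (2 * m%:R * (lams - lamb - 2 * M * Num.sqrt D0))
                       (4 * m%:R * M * Num.sqrt D0 / ln 2) in
  let condA :=
    D0 <= 1 - (Num.sqrt 2)^-1 /\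
    (* the second bound is +oo when its denominator vanishes *)
    (M + 2 * Num.sqrt L0 != 0 ->
     D0 <= (lams - lamb) ^+ 2 / (4 * (M + 2 * Num.sqrt L0) ^+ 2)) in
  let condB := L <= (lams - lamb - 2 * M * Num.sqrt D0) ^+ 2 / 32 in
  let condC :=
    den3 != 0 /\ eta <= (Num.max 1 (Num.max nu1 (Num.max nu2 nu3)))^-1 in
  let condD := den4 != 0 /\ eta <= (Num.max 1 (Num.max nu4 nu5))^-1 in
  let rho := eta * m%:R * (lams - lamb - 2 * M * Num.sqrt D0)
             / (2 * (1 - eta + eta * (lams - M * Num.sqrt D0))) in
  let delta := gap f p eta s m v x0 in
  condA -> condB \/ condC -> condD ->
  forall eps : R, 0 < eps ->
  let tau := nat_ceil (rho^-1 * ln (delta 0%N / eps)) in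
  (* the first conjunct says that the ratio delta tau is meaningful *)
  0 < gap_den f p eta s m v x0 tau /\ delta tau <= eps.
Proof.
move=> lamb sigma M D0 theta1 theta2 nu1 nu2 den3 nu3 den4 nu4 nu5.
move=> condA condB condC condD rho delta [A1 A2] hBC hD eps eps0 tau.
have [e0 e1] := andP eta_range; have [s0 sn] := andP hs.
have lamb_ge k : k != ord0 -> `|lam k| <= lamb.
  by move=> k0; exact: (le_bigmax_cond 0 (fun i => `|lam i|) k0).
have lamb0 : 0 <= lamb by exact: bigmax_ge_id.
have M1M : M1 <= M by rewrite /M le_max lexx.
have D00 : 0 <= D0.
  rewrite /D0 subr_ge0; apply: le_trans (dotv_le x0 xs) _.
  by rewrite (x0_sphere : norm2 x0 = 1) (xs_sphere : norm2 xs = 1) mulr1.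
have s20 : 0 < (Num.sqrt 2)^-1 :> R by rewrite invr_gt0 sqrtr_gt0.
have D1 : D0 <= 1 by apply: le_trans A1 _; rewrite gerBl ltW.
have [mu muE] : {mu | mu = M * Num.sqrt D0} by exists (M * Num.sqrt D0).
have [G0 noise_bound nu4_bound nu5_bound nu5_bound_ln] :=
  parameter_bounds e0 e1 lamb0 lam_gap (spectral_norm_ge0 _ : 0 <= sigma)
    (le_trans (M1_ge0 hM1) M1M) (L_ge0 hL)
    (L_max_mono f_scale f_smooth f_ball s0 hL hL0) D00 D1 hm muE
    (erefl theta1) (erefl theta2) (erefl den3) (erefl den4) (erefl nu3)
    (erefl nu4) (erefl nu5) A2 hBC hD.
have rhoE : rho = eta * m%:R * (lams - lamb - 2 * mu) /
    (2 * (1 - eta + eta * (lams - mu))).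
  by rewrite /rho muE (mulrA 2 M).
have Px0 : dotv x0 xs = 1 - D0 by rewrite /D0 subKr.
have cone0 : cone xs D0 x0.
  split; rewrite Px0; last by rewrite (x0_sphere : norm2 x0 = 1) mulr1.
  by rewrite subr_gt0; apply: le_lt_trans A1 _; rewrite gtrBl.
rewrite /tau rhoE.
exact: (gap_at_ceil f_scale f_smooth f_ball xs_sphere xs_grad v_eigen
  v_orthonormal v_first hs eta_range hM1 M1M hK hL lamb_ge lamb0 D00 A1 muE G0 hm
  noise_bound nu4_bound nu5_bound nu5_bound_ln cone0 eps0).
Qed.
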